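(* The calculus (with the terms, types, typing rules, full reduction $\rightarrow$ and normal forms given in the context) has the following properties. (1) Progress: if $t$ is a well-typed term all of whose free variables have interpretable types, then either $t$ is a normal form $\mathit{nf}$ or there is a term $t'$ with $t\rightarrow t'$. (2) Preservation: if $t:T$ (free variables of interpretable types allowed) and $t\rightarrow t'$, then $t':T$. (3) Confluence: if $t\rightarrow^* t_1$ and $t\rightarrow^* t_2$ then there is $t_3$ with $t_1\rightarrow^* t_3$ and $t_2\rightarrow^* t_3$; in particular each term has at most one normal form. (4) If a (well-typed) term $t$ contains no subterm of the form $\mathit{fix}~t'$, then $t$ is strongly normalizable (there is no infinite reduction sequence starting from $t$).
   Context: Types. $\mathsf B$ denotes base types (such as $\mathbb R,\mathbb C$). Types: $T::=\mathsf B\mid (T_1,\dots,T_n)\mid T\to T\mid T+T$. Interpretable types: $iB::=\mathsf B\mid iB\to iB$. Addable types: $T^*::=\mathsf B\mid (T^*,\dots,T^* )\mid T\to T^*$. Notation: $\frac{\partial T}{\partial \mathsf B}=T$, $\frac{\partial T}{\partial (T_1,\dots,T_n)}=(\frac{\partial T}{\partial T_1},\dots,\frac{\partial T}{\partial T_n})$; $\frac{\partial T}{\partial S}$ is undefined if $S$ is a function or sum type. Terms. $t::=c\mid x\mid \lambda x{:}T.t\mid t\,t\mid (t_1,\dots,t_n)\mid \pi_j t\mid t\oplus t\mid t\ominus t\mid t*t\mid \frac{\partial t}{\partial x}|_{t}\mid \int_{t}^{t}t\,dx\mid inl~t\mid inr~t\mid case~t~of~inl~x_1\Rightarrow t\mid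 inr~x_2\Rightarrow t\mid \mathit{fix}~t$, where constants $c$ have interpretable types; $x$ is bound in $t_1$ in $\frac{\partial t_1}{\partial x}|_{t_2}$ and in $t$ in $\int_{t_1}^{t_2}t\,dx$. Terms are taken up to $\alpha$-equivalence. Typing. The usual rules for constants, variables, abstraction, application, tuples, projections, injections, case; $\mathit{fix}~t:T$ if $t:T\to T$; $t_1\oplus t_2,\ t_1\ominus t_2:T^*$ if $t_1,t_2:T^*$; $\Gamma\vdash \frac{\partial t_2}{\partial x}|_{t_1}:\frac{\partial T_2}{\partial T_1}$ if $\Gamma\vdash t_1:T_1$ and $\Gamma,x{:}T_1\vdash t_2:T_2$; $t_1*t_2:T^*$ if $t_1:\frac{\partial T^*}{\partial T}$ and $t_2:T$; $\Gamma\vdash\int_{t_1}^{t_2}t\,dx:T^*$ if $\Gamma\vdash t_1,t_2:T$ and $\Gamma,x{:}T\vdash t:\frac{\partial T^*}{\partial T}$. Reduction $\rightarrow$ is full reduction: any of the following rules may be applied to any subterm (also under binders); $\rightarrow^*$ is its reflexive transitive closure. $(\lambda x{:}T.t)t_1\rightarrow t[t_1/x]$; $\pi_j(t_1,\dots,t_n)\rightarrow t_j$; $case~(inl~t)~of~inl~x_1\Rightarrow t_1\mid inr~x_2\Rightarrow t_2\rightarrow t_1[t/x_1]$; $case~(inr~t)~of~inl~x_1\Rightarrow t_1\mid inr~x_2\Rightarrow t_2\rightarrow t_2[t/x_2]$; $\mathit{fix}~f\rightarrow f(\mathit{fix}~f)$. Derivative, if $t_0:\mathsf B$: $\frac{\partial(t_1,\dots,t_n)}{\partial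 x}|_{t_0}\rightarrow(\frac{\partial t_1}{\partial x}|_{t_0},\dots,\frac{\partial t_n}{\partial x}|_{t_0})$; $\frac{\partial\, inl/inr~t}{\partial x}|_{t_0}\rightarrow inl/inr~\frac{\partial t}{\partial x}|_{t_0}$; $\frac{\partial(\lambda y:T.t)}{\partial x}|_{t_0}\rightarrow\lambda y{:}T.\frac{\partial t}{\partial x}|_{t_0}$. At a tuple: $\frac{\partial t}{\partial x}|_{(t_1,\dots,t_n)}\rightarrow(\frac{\partial t[t_{1*}/x]}{\partial x_1}|_{t_1},\dots,\frac{\partial t[t_{n*}/x]}{\partial x_n}|_{t_n})$ with $t_{i*}=(t_1,\dots,t_{i-1},x_i,t_{i+1},\dots,t_n)$, $x_i$ fresh. Integral, if $t_1,t_2:\mathsf B$: $\int_{t_1}^{t_2}(s_1,\dots,s_n)dx\rightarrow(\int_{t_1}^{t_2}s_1dx,\dots,\int_{t_1}^{t_2}s_ndx)$; $\int_{t_1}^{t_2}inl/inr~t\,dx\rightarrow inl/inr\int_{t_1}^{t_2}t\,dx$; $\int_{t_1}^{t_2}\lambda y{:}T.t\,dx\rightarrow\lambda y{:}T.\int_{t_1}^{t_2}t\,dx$. Between tuples: $\int_{(t_{11},\dots,t_{1n})}^{(t_{21},\dots,t_{2n})}t\,dx\rightarrow\int_{t_{11}}^{t_{21}}\pi_1(t[t_{1*}/x])dx_1\oplus\cdots\oplus\int_{t_{1n}}^{t_{2n}}\pi_n(t[t_{n*}/x])dx_n$ with $t_{i*}=(t_{21},\dots,t_{2(i-1)},x_i,t_{1(i+1)},\dots,t_{1n})$.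 For $\odot\in\{\oplus,\ominus\}$: $(t_{11},\dots,t_{1n})\odot(t_{21},\dots,t_{2n})\rightarrow(t_{11}\odot t_{21},\dots,t_{1n}\odot t_{2n})$; $(\lambda x{:}T.t_1)\odot(\lambda y{:}T.t_2)\rightarrow\lambda x{:}T.(t_1\odot t_2[x/y])$. Multiplication, if $t_0:\mathsf B$: $(t_1,\dots,t_n)*t_0\rightarrow(t_1*t_0,\dots,t_n*t_0)$; $(\lambda x{:}T.t)*t_0\rightarrow\lambda x{:}T.(t*t_0)$; $(inl/inr~t)*t_0\rightarrow inl/inr~(t*t_0)$. Between tuples: $(t_{11},\dots,t_{1n})*(t_{21},\dots,t_{2n})\rightarrow(t_{11}*t_{21})\oplus\cdots\oplus(t_{1n}*t_{2n})$. There are no reduction rules for operations on base-type constants. Normal forms. $\mathit{nf}::=\mathit{nb}\mid(\mathit{nf},\dots,\mathit{nf})\mid\lambda x{:}T.t$ (with $t$ not further reducible) $\mid inl/inr~\mathit{nf}$, where $\mathit{nb}::=c\mid x$ (constants and variables of interpretable types) $\mid\mathit{nb}~\mathit{nf}\mid\mathit{nb}\oplus\mathit{nf}\mid\mathit{nf}\oplus\mathit{nb}\mid\mathit{nb}\ominus\mathit{nf}\mid\mathit{nf}\ominus\mathit{nb}\mid\mathit{nb}*\mathit{nb}\mid\frac{\partial\,\mathit{nb}}{\partial x}|_{\mathit{nb}}\mid\int_{\mathit{nb}}^{\mathit{nb}}\mathit{nb}\,dx$.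
   Formalization: Confluence and uniqueness of normal forms are stated for well-typed terms only (they fail for ill-typed ones), and the variables bound by case carry type annotations, since otherwise the side condition t0:B is undetermined and preservation fails; tuples have at least one component. *)

(* Defs.v *)
From Stdlib Require Export List Relations.
Export ListNotations.

Set Implicit Arguments.

(* Tuple types are non-empty: [TTup T1 Ts] is (T1, Ts), so n >= 1.  With n = 0 the
   sums produced by the reduction of products and integrals of tuples would be
   empty.  A one-component tuple (T) is distinct from T. *)
Inductive ty (B : Type) : Type :=
| TBase (b : B)
| TTup (T1 : ty B) (Ts : list (ty B))
| TArr (S T : ty B)
| TSum (T1 T2 : ty B).

Inductive interpretable {B : Type} : ty B -> Prop :=
| interp_base b : interpretable (TBase b)
| interp_arr S T : interpretable S -> interpretable T -> interpretable (TArr S T).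

Inductive addable {B : Type} : ty B -> Prop :=
| addable_base b : addable (TBase b)
| addable_tup T1 Ts : Forall addable (T1 :: Ts) -> addable (TTup T1 Ts)
| addable_arr S T : addable T -> addable (TArr S T).

(* [dty T S D]: the type dT/dS is defined and equal to D. *)
Inductive dty {B : Type} (T : ty B) : ty B -> ty B -> Prop :=
| dty_base b : dty T (TBase b) T
| dty_tup S1 Ss D1 Ds :
    Forall2 (dty T) (S1 :: Ss) (D1 :: Ds) -> dty T (TTup S1 Ss) (TTup D1 Ds).

Record signature : Type := Signature {
  base : Type;
  const : Type;
  const_ty : const -> ty base;
  const_interp : forall c, interpretable (const_ty c) }.

Inductive addop : Type := Oplus | Ominus.

Inductive side : Type := L | R.

(* de Bruijn terms, so that equality is alpha-equivalence.  The binders are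
   - [Lam T t]: one variable in t;
   - [Der t t0] (dt/dx at t0): one variable in t;
   - [Int t1 t2 t] (integral of t from t1 to t2): one variable in t;
   - [Case t T1 u1 T2 u2]: one variable in u1, one in u2.
   Projections are numbered from 0.

   The variables bound by [Case] carry their types, as the variable bound by a
   lambda does.  Reduction has side conditions of the form t0 : B for open t0, so
   the types of the bound variables have to be determined by the term.  The types
   of the variables bound by [Der] and [Int] are those of the point and of the
   bounds, but a scrutinee such as [inl t] has type T1 + T2 for every T2, and would
   leave the type of the variable of the other branch undetermined; preservation
   and confluence would then depend on the choice of this type.

   [Tup []] is not typable. *)
Inductive term (Sg : signature) : Type :=
| Cst (c : const Sg)
| Var (i : nat)
| Lam (T : ty (base Sg)) (t : term Sg)
| App (t u : term Sg)
| Tup (ts : list (term Sg))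
| Proj (j : nat) (t : term Sg)
| Op (o : addop) (t u : term Sg)
| Mul (t u : term Sg)
| Der (t t0 : term Sg)
| Int (t1 t2 t : term Sg)
| Inj (s : side) (t : term Sg)
| Case (t : term Sg) (T1 : ty (base Sg)) (u1 : term Sg) (T2 : ty (base Sg)) (u2 : term Sg)
| Fix (t : term Sg).

Arguments Cst {Sg} c.
Arguments Var {Sg} i.

Definition ctx (Sg : signature) : Type := list (ty (base Sg)).

Definition up_ren (f : nat -> nat) (i : nat) : nat :=
  match i with 0 => 0 | S i => S (f i) end.

Fixpoint ren {Sg} (f : nat -> nat) (t : term Sg) : term Sg :=
  match t with
  | Cst c => Cst c
  | Var i => Var (f i)
  | Lam T t => Lam T (ren (up_ren f) t)
  | App t u => App (ren f t) (ren f u)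
  | Tup ts => Tup (map (ren f) ts)
  | Proj j t => Proj j (ren f t)
  | Op o t u => Op o (ren f t) (ren f u)
  | Mul t u => Mul (ren f t) (ren f u)
  | Der t t0 => Der (ren (up_ren f) t) (ren f t0)
  | Int t1 t2 t => Int (ren f t1) (ren f t2) (ren (up_ren f) t)
  | Inj s t => Inj s (ren f t)
  | Case t T1 u1 T2 u2 => Case (ren f t) T1 (ren (up_ren f) u1) T2 (ren (up_ren f) u2)
  | Fix t => Fix (ren f t)
  end.

Definition lift {Sg} : term Sg -> term Sg := ren S.

Definition swap01 (i : nat) : nat :=
  match i with 0 => 1 | 1 => 0 | _ => i end.

Definition scons {Sg} (u : term Sg) (s : nat -> term Sg) (i : nat) : term Sg :=
  match i with 0 => u | S i => s i end.

Definition up {Sg} (s : nat -> term Sg) : nat -> term Sg :=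
  scons (Var 0) (fun i => lift (s i)).

Fixpoint subst {Sg} (s : nat -> term Sg) (t : term Sg) : term Sg :=
  match t with
  | Cst c => Cst c
  | Var i => s i
  | Lam T t => Lam T (subst (up s) t)
  | App t u => App (subst s t) (subst s u)
  | Tup ts => Tup (map (subst s) ts)
  | Proj j t => Proj j (subst s t)
  | Op o t u => Op o (subst s t) (subst s u)
  | Mul t u => Mul (subst s t) (subst s u)
  | Der t t0 => Der (subst (up s) t) (subst s t0)
  | Int t1 t2 t => Int (subst s t1) (subst s t2) (subst (up s) t)
  | Inj d t => Inj d (subst s t)
  | Case t T1 u1 T2 u2 => Case (subst s t) T1 (subst (up s) u1) T2 (subst (up s) u2)
  | Fix t => Fix (subst s t)
  end.

Definition subst1 {Sg} (t u : term Sg) : term Sg := subst (scons u Var) t.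

(* The tuple (us_1, ..., us_{i-1}, x_i, vs_{i+1}, ..., vs_n), where x_i is the
   variable of index 0 and us, vs do not depend on it. *)
Definition tup_star {Sg} (i : nat) (us vs : list (term Sg)) : term Sg :=
  Tup (map lift (firstn i us) ++ Var 0 :: map lift (skipn (S i) vs)).

(* t[u/x] when u depends on a fresh variable which takes the place of x as the
   variable of index 0. *)
Definition subst_fresh {Sg} (t u : term Sg) : term Sg :=
  subst (scons u (fun i => Var (S i))) t.

Definition der_tup {Sg} (t : term Sg) (ts : list (term Sg)) : list (term Sg) :=
  map (fun '(i, ti) => Der (subst_fresh t (tup_star i ts ts)) ti)
      (combine (seq 0 (length ts)) ts).

Definition int_tup {Sg} (ts1 ts2 : list (term Sg)) (t : term Sg) : list (term Sg) :=
  map (fun '(i, (t1, t2)) => Int t1 t2 (Proj i (subst_fresh t (tup_star i ts2 ts1))))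
      (combine (seq 0 (length ts1)) (combine ts1 ts2)).

Definition zip_with {A B D : Type} (f : A -> B -> D) (xs : list A) (ys : list B) : list D :=
  map (fun '(x, y) => f x y) (combine xs ys).

(* t (+) u_1 (+) ... (+) u_k, associated to the left *)
Definition osum {Sg} (t : term Sg) (us : list (term Sg)) : term Sg :=
  fold_left (Op Oplus) us t.

Inductive has_type {Sg} : ctx Sg -> term Sg -> ty (base Sg) -> Prop :=
| ty_cst G c : has_type G (Cst c) (const_ty Sg c)
| ty_var G i T : nth_error G i = Some T -> has_type G (Var i) T
| ty_lam G S T t : has_type (S :: G) t T -> has_type G (Lam S t) (TArr S T)
| ty_app G S T t u : has_type G t (TArr S T) -> has_type G u S -> has_type G (App t u) T
| ty_tup G ts T1 Ts :
    Forall2 (has_type G) ts (T1 :: Ts) -> has_type G (Tup ts) (TTup T1 Ts)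
| ty_proj G j t T1 Ts T :
    has_type G t (TTup T1 Ts) -> nth_error (T1 :: Ts) j = Some T -> has_type G (Proj j t) T
| ty_op G o t u T :
    addable T -> has_type G t T -> has_type G u T -> has_type G (Op o t u) T
| ty_mul G t u S T D :
    addable T -> dty T S D -> has_type G t D -> has_type G u S -> has_type G (Mul t u) T
| ty_der G t t0 S T D :
    has_type G t0 S -> has_type (S :: G) t T -> dty T S D -> has_type G (Der t t0) D
| ty_int G t1 t2 t S T D :
    addable T -> dty T S D -> has_type G t1 S -> has_type G t2 S ->
    has_type (S :: G) t D -> has_type G (Int t1 t2 t) T
| ty_inl G t T1 T2 : has_type G t T1 -> has_type G (Inj L t) (TSum T1 T2)
| ty_inr G t T1 T2 : has_type G t T2 -> has_type G (Inj R t) (TSum T1 T2)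
| ty_case G t T1 u1 T2 u2 T :
    has_type G t (TSum T1 T2) -> has_type (T1 :: G) u1 T -> has_type (T2 :: G) u2 T ->
    has_type G (Case t T1 u1 T2 u2) T
| ty_fix G t T : has_type G t (TArr T T) -> has_type G (Fix t) T.

Definition has_base_type {Sg} (G : ctx Sg) (t : term Sg) : Prop :=
  exists b, has_type G t (TBase b).

(* Reduction of a redex.  The context gives the types of the free variables, on
   which the side conditions t0 : B depend. *)
Inductive red {Sg} (G : ctx Sg) : term Sg -> term Sg -> Prop :=
| red_beta T t u : red G (App (Lam T t) u) (subst1 t u)
| red_proj j ts t : nth_error ts j = Some t -> red G (Proj j (Tup ts)) t
| red_case_inl t T1 u1 T2 u2 : red G (Case (Inj L t) T1 u1 T2 u2) (subst1 u1 t)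
| red_case_inr t T1 u1 T2 u2 : red G (Case (Inj R t) T1 u1 T2 u2) (subst1 u2 t)
| red_fix t : red G (Fix t) (App t (Fix t))
| red_der_tup ts t0 :
    has_base_type G t0 ->
    red G (Der (Tup ts) t0) (Tup (map (fun t => Der t t0) ts))
| red_der_inj s t t0 :
    has_base_type G t0 -> red G (Der (Inj s t) t0) (Inj s (Der t t0))
| red_der_lam T t t0 :
    has_base_type G t0 ->
    red G (Der (Lam T t) t0) (Lam T (Der (ren swap01 t) (lift t0)))
| red_der_at_tup t ts : red G (Der t (Tup ts)) (Tup (der_tup t ts))
| red_int_tup t1 t2 ts :
    has_base_type G t1 -> has_base_type G t2 ->
    red G (Int t1 t2 (Tup ts)) (Tup (map (fun t => Int t1 t2 t) ts))
| red_int_inj t1 t2 s t :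
    has_base_type G t1 -> has_base_type G t2 ->
    red G (Int t1 t2 (Inj s t)) (Inj s (Int t1 t2 t))
| red_int_lam t1 t2 T t :
    has_base_type G t1 -> has_base_type G t2 ->
    red G (Int t1 t2 (Lam T t)) (Lam T (Int (lift t1) (lift t2) (ren swap01 t)))
| red_int_between_tup ts1 ts2 t u us :
    length ts1 = length ts2 -> int_tup ts1 ts2 t = u :: us ->
    red G (Int (Tup ts1) (Tup ts2) t) (osum u us)
| red_op_tup o ts1 ts2 :
    length ts1 = length ts2 ->
    red G (Op o (Tup ts1) (Tup ts2)) (Tup (zip_with (@Op Sg o) ts1 ts2))
| red_op_lam o T t1 t2 : red G (Op o (Lam T t1) (Lam T t2)) (Lam T (Op o t1 t2))
| red_mul_tup_base ts t0 :
    has_base_type G t0 -> red G (Mul (Tup ts) t0) (Tup (map (fun t => Mul t t0) ts))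
| red_mul_lam T t t0 :
    has_base_type G t0 -> red G (Mul (Lam T t) t0) (Lam T (Mul t (lift t0)))
| red_mul_inj s t t0 :
    has_base_type G t0 -> red G (Mul (Inj s t) t0) (Inj s (Mul t t0))
| red_mul_tup_tup ts1 ts2 u us :
    length ts1 = length ts2 -> zip_with (@Mul Sg) ts1 ts2 = u :: us ->
    red G (Mul (Tup ts1) (Tup ts2)) (osum u us).

Inductive step {Sg} : ctx Sg -> term Sg -> term Sg -> Prop :=
| step_red G t t' : red G t t' -> step G t t'
| step_lam G T t t' : step (T :: G) t t' -> step G (Lam T t) (Lam T t')
| step_app1 G t t' u : step G t t' -> step G (App t u) (App t' u)
| step_app2 G t u u' : step G u u' -> step G (App t u) (App t u')
| step_tup G ts1 t t' ts2 :
    step G t t' -> step G (Tup (ts1 ++ t :: ts2)) (Tup (ts1 ++ t' :: ts2))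
| step_proj G j t t' : step G t t' -> step G (Proj j t) (Proj j t')
| step_op1 G o t t' u : step G t t' -> step G (Op o t u) (Op o t' u)
| step_op2 G o t u u' : step G u u' -> step G (Op o t u) (Op o t u')
| step_mul1 G t t' u : step G t t' -> step G (Mul t u) (Mul t' u)
| step_mul2 G t u u' : step G u u' -> step G (Mul t u) (Mul t u')
| step_der_body G S t t' t0 :
    has_type G t0 S -> step (S :: G) t t' -> step G (Der t t0) (Der t' t0)
| step_der_point G t t0 t0' : step G t0 t0' -> step G (Der t t0) (Der t t0')
| step_int_lower G t1 t1' t2 t : step G t1 t1' -> step G (Int t1 t2 t) (Int t1' t2 t)
| step_int_upper G t1 t2 t2' t : step G t2 t2' -> step G (Int t1 t2 t) (Int t1 t2' t)
| step_int_body G S t1 t2 t t' :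
    has_type G t1 S -> has_type G t2 S -> step (S :: G) t t' ->
    step G (Int t1 t2 t) (Int t1 t2 t')
| step_inj G s t t' : step G t t' -> step G (Inj s t) (Inj s t')
| step_case G t t' T1 u1 T2 u2 :
    step G t t' -> step G (Case t T1 u1 T2 u2) (Case t' T1 u1 T2 u2)
| step_case_inl G t T1 u1 u1' T2 u2 :
    step (T1 :: G) u1 u1' -> step G (Case t T1 u1 T2 u2) (Case t T1 u1' T2 u2)
| step_case_inr G t T1 u1 T2 u2 u2' :
    step (T2 :: G) u2 u2' -> step G (Case t T1 u1 T2 u2) (Case t T1 u1 T2 u2')
| step_fix G t t' : step G t t' -> step G (Fix t) (Fix t').

Definition steps {Sg} (G : ctx Sg) : term Sg -> term Sg -> Prop :=
  clos_refl_trans (term Sg) (step G).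

Inductive nb {Sg} : ctx Sg -> term Sg -> Prop :=
| nb_cst G c : nb G (Cst c)
| nb_var G i T : nth_error G i = Some T -> interpretable T -> nb G (Var i)
| nb_app G t u : nb G t -> nf G u -> nb G (App t u)
| nb_op1 G o t u : nb G t -> nf G u -> nb G (Op o t u)
| nb_op2 G o t u : nf G t -> nb G u -> nb G (Op o t u)
| nb_mul G t u : nb G t -> nb G u -> nb G (Mul t u)
| nb_der G S t t0 : has_type G t0 S -> nb (S :: G) t -> nb G t0 -> nb G (Der t t0)
| nb_int G S t1 t2 t :
    has_type G t1 S -> has_type G t2 S ->
    nb G t1 -> nb G t2 -> nb (S :: G) t -> nb G (Int t1 t2 t)
with nf {Sg} : ctx Sg -> term Sg -> Prop :=
| nf_nb G t : nb G t -> nf G t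
| nf_tup G ts : Forall (nf G) ts -> nf G (Tup ts)
| nf_lam G T t : (~ exists t', step (T :: G) t t') -> nf G (Lam T t)
| nf_inj G s t : nf G t -> nf G (Inj s t).

Fixpoint occurs_free {Sg} (i : nat) (t : term Sg) : bool :=
  match t with
  | Cst _ => false
  | Var k => Nat.eqb i k
  | Lam _ t => occurs_free (S i) t
  | App t u | Op _ t u | Mul t u => orb (occurs_free i t) (occurs_free i u)
  | Tup ts => existsb (occurs_free i) ts
  | Proj _ t | Inj _ t | Fix t => occurs_free i t
  | Der t t0 => orb (occurs_free (S i) t) (occurs_free i t0)
  | Int t1 t2 t =>
      orb (occurs_free i t1) (orb (occurs_free i t2) (occurs_free (S i) t))
  | Case t _ u1 _ u2 =>
      orb (occurs_free i t) (orb (occurs_free (S i) u1) (occurs_free (S i) u2))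
  end.

Definition interpretable_fv {Sg} (G : ctx Sg) (t : term Sg) : Prop :=
  forall i T, occurs_free i t = true -> nth_error G i = Some T -> interpretable T.

Fixpoint fix_free {Sg} (t : term Sg) : bool :=
  match t with
  | Cst _ | Var _ => true
  | Lam _ t | Proj _ t | Inj _ t => fix_free t
  | App t u | Op _ t u | Mul t u | Der t u => andb (fix_free t) (fix_free u)
  | Tup ts => forallb fix_free ts
  | Int t1 t2 t => andb (fix_free t1) (andb (fix_free t2) (fix_free t))
  | Case t _ u1 _ u2 => andb (fix_free t) (andb (fix_free u1) (fix_free u2))
  | Fix _ => false
  end.

Definition strongly_normalizable {Sg} (G : ctx Sg) (t : term Sg) : Prop :=
  ~ exists f : nat -> term Sg, f 0 = t /\ forall n, step G (f n) (f (S n)).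

(* Main.v *)
(* The side conditions on the points of derivatives, on the bounds of integrals and on
   the second factors of products only involve types without sums, and the type of a
   term is unique up to the ambiguity that injections create below sums.  Terms are
   therefore annotated with these types: reduction becomes independent of the typing
   context, typed terms and annotated typed terms simulate each other, and it is enough
   to study annotated terms.  There the rules are orthogonal, which gives confluence
   through a parallel reduction.  Strong normalization is by reducibility: a term is
   reducible if it is strongly normalizing and all the values it reduces to have the
   shape of its type and reducible components; that derivatives, integrals and products
   preserve reducibility is shown by induction on the type of the point, and at a base
   type by induction on the type of the body. *)

From Stdlib Require Import Arith Lia Classical FunctionalExtensionality.
Require Import Defs.

(** * Lists *)

(** Confluence cannot rest on termination, since [Fix] unfolds forever; hence a parallel reduction
    rather than local confluence. On the original terms, two rules compete syntactically when the
    body and the point of a derivative are both tuples, and only a typing side condition separates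
    them. With annotations the choice between [TBase] and [TTup] belongs to the head symbol, so that
    annotated reduction is confluent even on ill-typed terms. Two diverging reductions of a typed
    term are lifted from the same annotated term.

    Reducibility is stated through the values that a term reaches and not through eliminations: the
    elimination of a sum has a result of arbitrary type, and the rules for derivatives and integrals
    inspect a body that is still open. An open body is treated as reducible when all its instances
    by reducible terms are; its instances by variables, which are reducible at every type, then give
    back its shape and its strong normalization. *)

Lemma Forall2_nth {A B} (R : A -> B -> Prop) l l' :
  Forall2 R l l' ->
  forall i x y, nth_error l i = Some x -> nth_error l' i = Some y -> R x y.
Proof.
  induction 1; intros [|i] a b; simpl; try discriminate.
  - congruence.
  - apply IHForall2.
Qed.

Lemma Forall2_nth_l {A B} (R : A -> B -> Prop) l l' :
  Forall2 R l l' ->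
  forall i x, nth_error l i = Some x -> exists y, nth_error l' i = Some y /\ R x y.
Proof.
  induction 1; intros [|i] a; simpl; try discriminate.
  - injection 1 as <-. eauto.
  - apply IHForall2.
Qed.

Lemma Forall2_nth_r {A B} (R : A -> B -> Prop) l l' :
  Forall2 R l l' ->
  forall i y, nth_error l' i = Some y -> exists x, nth_error l i = Some x /\ R x y.
Proof.
  induction 1; intros [|i] a; simpl; try discriminate.
  - injection 1 as <-. eauto.
  - apply IHForall2.
Qed.

Lemma Forall2_mono {A B} (P : A -> Prop) (R Q : A -> B -> Prop) l l' :
  Forall P l -> (forall x y, P x -> R x y -> Q x y) -> Forall2 R l l' -> Forall2 Q l l'.
Proof. intros H HPQ; induction 1; inversion H; subst; auto. Qed.

Lemma Forall2_refl_on {A} (P : A -> Prop) (R : A -> A -> Prop) l :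
  (forall x, P x -> R x x) -> Forall P l -> Forall2 R l l.
Proof. induction 2; auto. Qed.

Lemma Forall2_map2 {A B A' B'} (R : A' -> B' -> Prop) (f : A -> A') (g : B -> B') l l' :
  Forall2 (fun x y => R (f x) (g y)) l l' -> Forall2 R (map f l) (map g l').
Proof. induction 1; simpl; auto. Qed.

Lemma Forall2_map_l {A B A'} (R : A' -> B -> Prop) (f : A -> A') l l' :
  Forall2 (fun x y => R (f x) y) l l' -> Forall2 R (map f l) l'.
Proof. induction 1; simpl; auto. Qed.

(** The spliced list has the components of the tuple $t_{i*}$ of the rules, with [u] for $x_i$; the
    relation will be typing or reducibility. *)
Lemma Forall2_splice {A B} (R : A -> B -> Prop) xs us vs i x u :
  Forall2 R xs us -> Forall2 R xs vs -> nth_error xs i = Some x -> R x u ->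
  Forall2 R xs (firstn i us ++ u :: skipn (S i) vs).
Proof.
  intros H; revert vs i; induction H; intros vs [|i] Hv Hi Hu; inversion Hv; subst;
    try discriminate; simpl in *.
  - injection Hi as ->. auto.
  - constructor; auto.
Qed.

Lemma Forall2_splice2 {A B} (R : A -> B -> Prop) us us' vs vs' i u u' :
  Forall2 R us us' -> Forall2 R vs vs' -> R u u' ->
  Forall2 R (firstn i us ++ u :: skipn (S i) vs) (firstn i us' ++ u' :: skipn (S i) vs').
Proof.
  intros H Hv Hu; apply Forall2_app.
  - clear - H; revert i; induction H; intros [|i]; simpl; auto.
  - constructor; auto.
    generalize (S i); clear - Hv; induction Hv; intros [|i]; simpl; auto.
Qed.

(** Structurally recursive counterpart of the maps over [combine (seq ...)] in [der_tup] and
    [int_tup]; the start [k] varies so that inductions on the list go through. *)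
Fixpoint imap {A B} (f : nat -> A -> B) (k : nat) (l : list A) : list B :=
  match l with [] => [] | x :: l => f k x :: imap f (S k) l end.

Lemma map_combine_seq {A B} (f : nat -> A -> B) k l :
  map (fun '(i, x) => f i x) (combine (seq k (length l)) l) = imap f k l.
Proof. revert k; induction l; intros k; simpl; [|rewrite IHl]; auto. Qed.

Lemma map_imap {A B D} (h : B -> D) (f : nat -> A -> B) k l :
  map h (imap f k l) = imap (fun i x => h (f i x)) k l.
Proof. revert k; induction l; intros k; simpl; [|rewrite IHl]; auto. Qed.

Lemma imap_map {A B D} (f : nat -> B -> D) (h : A -> B) k l :
  imap f k (map h l) = imap (fun i x => f i (h x)) k l.
Proof. revert k; induction l; intros k; simpl; [|rewrite IHl]; auto. Qed.

Lemma imap_id {A} k (l : list A) : imap (fun _ x => x) k l = l.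
Proof. revert k; induction l; intros k; simpl; [|rewrite IHl]; auto. Qed.

Lemma imap_ext {A B} (f g : nat -> A -> B) k l :
  (forall i x, f i x = g i x) -> imap f k l = imap g k l.
Proof. intros H; revert k; induction l; intros k; simpl; [|rewrite IHl, H]; auto. Qed.

Lemma Forall2_imap {A A' B B'} (R : B -> B' -> Prop) (f : nat -> A -> B) (g : nat -> A' -> B')
    k l l' :
  length l = length l' ->
  (forall i x y, nth_error l i = Some x -> nth_error l' i = Some y ->
                 R (f (k + i) x) (g (k + i) y)) ->
  Forall2 R (imap f k l) (imap g k l').
Proof.
  revert k l'; induction l as [|x l IH]; intros k [|y l'] Hl H; try discriminate; simpl; auto.
  constructor.
  - generalize (H 0 x y eq_refl eq_refl). rewrite Nat.add_0_r. auto.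
  - injection Hl as Hl. apply IH; auto. intros i a b Ha Hb.
    generalize (H (S i) a b Ha Hb). rewrite Nat.add_succ_r. auto.
Qed.

Lemma Forall2_imap_l {A B D} (R : B -> D -> Prop) (f : nat -> A -> B) l l' :
  length l = length l' ->
  (forall i x y, nth_error l i = Some x -> nth_error l' i = Some y -> R (f i x) y) ->
  Forall2 R (imap f 0 l) l'.
Proof.
  intros Hl H. rewrite <- (imap_id 0 l'). apply Forall2_imap; auto.
Qed.

Lemma Forall_imap {A B} (P : B -> Prop) (f : nat -> A -> B) l :
  (forall i x, nth_error l i = Some x -> P (f i x)) -> Forall P (imap f 0 l).
Proof.
  intros H. assert (Hf : Forall2 (fun x _ => P x) (imap f 0 l) l).
  { apply Forall2_imap_l; eauto. }
  clear H. induction Hf; auto.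
Qed.

Lemma nth_error_combine {A B} (l : list A) (l' : list B) i x y :
  nth_error (combine l l') i = Some (x, y) ->
  nth_error l i = Some x /\ nth_error l' i = Some y.
Proof.
  revert l' i; induction l as [|a l IH]; intros [|b l'] [|i]; simpl; try discriminate; auto.
  injection 1 as -> ->. auto.
Qed.

Lemma combine_map_r {A B D} (f : B -> D) (l : list A) l' :
  combine l (map f l') = map (fun '(x, y) => (x, f y)) (combine l l').
Proof. revert l'; induction l; intros [|b l']; simpl; [| | |rewrite IHl]; auto. Qed.

Lemma combine_map2 {A B A' B'} (f : A -> A') (g : B -> B') l l' :
  combine (map f l) (map g l') = map (fun '(x, y) => (f x, g y)) (combine l l').
Proof. revert l'; induction l; intros [|b l']; simpl; [| | |rewrite IHl]; auto. Qed.

(** * Annotated terms *)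

(* A node is made of a label, of subterms under no binder, and of subterms under
   one binder.  Derivatives, integrals and products carry the type of the point,
   of the bounds, of the second factor, so that no side condition of a reduction
   rule depends on the context.  *)

Section Calculus.

Context {Sg : signature}.

Notation typ := (ty (base Sg)).

Inductive label : Type :=
| LCst (c : const Sg)
| LLam (T : typ)
| LApp
| LTup
| LProj (j : nat)
| LOp (o : addop)
| LMul (S : typ)
| LDer (S : typ)
| LInt (S : typ)
| LInj (s : side)
| LCase (T1 T2 : typ)
| LFix.

Inductive tm : Type :=
| tvar (i : nat)
| node (l : label) (ts bs : list tm).

Notation aLam T t := (node (LLam T) [] [t]).
Notation aApp t u := (node LApp [t; u] []).
Notation aTup ts := (node LTup ts []).
Notation aProj j t := (node (LProj j) [t] []).
Notation aOp o t u := (node (LOp o) [t; u] []).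
Notation aMul S t u := (node (LMul S) [t; u] []).
Notation aDer S t t0 := (node (LDer S) [t0] [t]).
Notation aInt S t1 t2 t := (node (LInt S) [t1; t2] [t]).
Notation aInj s t := (node (LInj s) [t] []).
Notation aCase t T1 u1 T2 u2 := (node (LCase T1 T2) [t] [u1; u2]).
Notation aFix t := (node LFix [t] []).

Fixpoint tm_nested_ind (P : tm -> Prop) (Hv : forall i, P (tvar i))
    (Hn : forall l ts bs, Forall P ts -> Forall P bs -> P (node l ts bs)) (a : tm) : P a :=
  let fix all ts : Forall P ts :=
    match ts with
    | [] => Forall_nil P
    | t :: ts => Forall_cons t (tm_nested_ind P Hv Hn t) (all ts)
    end in
  match a with
  | tvar i => Hv i
  | node l ts bs => Hn l ts bs (all ts) (all bs)
  end.

Fixpoint aren (f : nat -> nat) (a : tm) : tm :=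
  match a with
  | tvar i => tvar (f i)
  | node l ts bs => node l (map (aren f) ts) (map (aren (up_ren f)) bs)
  end.

Definition alift : tm -> tm := aren S.

Definition ascons (u : tm) (s : nat -> tm) (i : nat) : tm :=
  match i with 0 => u | S i => s i end.

Definition aup (s : nat -> tm) : nat -> tm := ascons (tvar 0) (fun i => alift (s i)).

Fixpoint asubst (s : nat -> tm) (a : tm) : tm :=
  match a with
  | tvar i => s i
  | node l ts bs => node l (map (asubst s) ts) (map (asubst (aup s)) bs)
  end.

Definition asubst1 (t u : tm) : tm := asubst (ascons u tvar) t.

(** * Calculus of renamings and substitutions *)

Lemma aren_asubst f a : aren f a = asubst (fun i => tvar (f i)) a.
Proof.
  revert f; induction a as [i|l ts bs IHt IHb] using tm_nested_ind; intros f; simpl; auto.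
  f_equal; apply map_ext_Forall.
  - eapply Forall_impl, IHt; auto.
  - eapply Forall_impl, IHb; simpl. intros b Hb. rewrite Hb. f_equal.
    extensionality i; destruct i; auto.
Qed.

Lemma asubst_aren s f a : asubst s (aren f a) = asubst (fun i => s (f i)) a.
Proof.
  revert s f; induction a as [i|l ts bs IHt IHb] using tm_nested_ind; intros s f; simpl; auto.
  rewrite !map_map. f_equal; apply map_ext_Forall.
  - eapply Forall_impl, IHt; auto.
  - eapply Forall_impl, IHb; simpl. intros b Hb. rewrite Hb. f_equal.
    extensionality i; destruct i; auto.
Qed.

(** Settled before the composition of two substitutions, which meets a shifted substitution under
    each binder. *)
Lemma aren_of_asubst s f a : aren f (asubst s a) = asubst (fun i => aren f (s i)) a.
Proof.
  revert s f; induction a as [i|l ts bs IHt IHb] using tm_nested_ind; intros s f; simpl; auto.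
  rewrite !map_map. f_equal; apply map_ext_Forall.
  - eapply Forall_impl, IHt; auto.
  - eapply Forall_impl, IHb; simpl. intros b Hb. rewrite Hb. f_equal.
    extensionality i; destruct i as [|i]; simpl; auto.
    unfold alift. rewrite (aren_asubst (up_ren f)), asubst_aren, (aren_asubst S), asubst_aren. auto.
Qed.

Lemma asubst_asubst s s' a : asubst s (asubst s' a) = asubst (fun i => asubst s (s' i)) a.
Proof.
  revert s s'; induction a as [i|l ts bs IHt IHb] using tm_nested_ind; intros s s'; simpl; auto.
  rewrite !map_map. f_equal; apply map_ext_Forall.
  - eapply Forall_impl, IHt; auto.
  - eapply Forall_impl, IHb; simpl. intros b Hb. rewrite Hb. f_equal.
    extensionality i; destruct i as [|i]; simpl; auto.
    unfold alift. rewrite asubst_aren, aren_of_asubst. auto.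
Qed.

Lemma asubst_tvar a : asubst tvar a = a.
Proof.
  induction a as [i|l ts bs IHt IHb] using tm_nested_ind; simpl; auto.
  f_equal; rewrite <- map_id; apply map_ext_Forall; auto.
  replace (aup tvar) with tvar; auto.
  extensionality i; destruct i; auto.
Qed.

Lemma asubst_alift s u a : asubst (ascons u s) (alift a) = asubst s a.
Proof. unfold alift. rewrite asubst_aren. auto. Qed.

Lemma asubst1_alift a u : asubst1 (alift a) u = a.
Proof. unfold asubst1. rewrite asubst_alift. apply asubst_tvar. Qed.

Lemma asubst_aup_alift s a : asubst (aup s) (alift a) = alift (asubst s a).
Proof.
  unfold alift. rewrite asubst_aren, aren_of_asubst. auto.
Qed.

Lemma asubst_asubst1 s t u : asubst s (asubst1 t u) = asubst1 (asubst (aup s) t) (asubst s u).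
Proof.
  unfold asubst1. rewrite !asubst_asubst. f_equal.
  extensionality i; destruct i as [|i]; simpl; auto.
  rewrite asubst_alift, asubst_tvar. auto.
Qed.

(** Lets the substitution in the fundamental property of reducibility grow by one value at each
    binder. *)
Lemma asubst1_aup s t u : asubst1 (asubst (aup s) t) u = asubst (ascons u s) t.
Proof.
  unfold asubst1. rewrite asubst_asubst. f_equal.
  extensionality i; destruct i as [|i]; simpl; auto.
  rewrite asubst_alift, asubst_tvar. auto.
Qed.

(** The substitution lifted twice fixes both exchanged variables, and its other values are shifted
    twice, so they contain neither. *)
Lemma asubst_swap s t :
  asubst (aup (aup s)) (aren swap01 t) = aren swap01 (asubst (aup (aup s)) t).
Proof.
  rewrite asubst_aren, aren_of_asubst. f_equal.
  extensionality i; destruct i as [|[|i]]; simpl; auto.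
  unfold alift. rewrite !aren_asubst, !asubst_asubst. auto.
Qed.

(** * Componentwise derivatives, integrals, products and sums *)

Definition atup_star (i : nat) (us vs : list tm) : tm :=
  aTup (map alift (firstn i us) ++ tvar 0 :: map alift (skipn (S i) vs)).

Definition asubst_fresh (t u : tm) : tm := asubst (ascons u (fun i => tvar (S i))) t.

(** The component types become the annotations of the partial derivatives. As [combine] truncates to
    the shorter list, the rule that uses this list requires the lengths to agree. *)
Definition ader_tup (Ss : list typ) (t : tm) (ts : list tm) : list tm :=
  imap (fun i '(T, ti) => aDer T (asubst_fresh t (atup_star i ts ts)) ti) 0 (combine Ss ts).

Definition aint_tup (Ss : list typ) (ts1 ts2 : list tm) (t : tm) : list tm :=
  imap (fun i '(T, (t1, t2)) => aInt T t1 t2 (aProj i (asubst_fresh t (atup_star i ts2 ts1))))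
    0 (combine Ss (combine ts1 ts2)).

Definition amul_tup (Ss : list typ) (ts1 ts2 : list tm) : list tm :=
  map (fun '(T, (t1, t2)) => aMul T t1 t2) (combine Ss (combine ts1 ts2)).

Definition aop_tup (o : addop) (ts1 ts2 : list tm) : list tm :=
  map (fun '(t1, t2) => aOp o t1 t2) (combine ts1 ts2).

Definition aosum (t : tm) (us : list tm) : tm := fold_left (fun a b => aOp Oplus a b) us t.

Lemma asubst_tup_star s i us vs :
  asubst (aup s) (atup_star i us vs) = atup_star i (map (asubst s) us) (map (asubst s) vs).
Proof.
  unfold atup_star. cbn -[skipn]. f_equal. rewrite map_app. cbn -[skipn].
  rewrite firstn_map, skipn_map, !map_map.
  f_equal; [|f_equal]; apply map_ext; intros a; apply asubst_aup_alift.
Qed.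

Lemma asubst_fresh_aup s t u :
  asubst (aup s) (asubst_fresh t u) = asubst_fresh (asubst (aup s) t) (asubst (aup s) u).
Proof.
  unfold asubst_fresh. rewrite !asubst_asubst. f_equal.
  extensionality i; destruct i as [|i]; simpl; auto.
  rewrite asubst_alift. unfold alift. apply aren_asubst.
Qed.

(** With the next lemma, this turns $t[t_{i*}/x][v/x_i]$ into the instance of [t] at the tuple whose
    i-th component is [v]: partial operations are thus controlled by the values of [t] at ordinary
    tuples. *)
Lemma asubst1_fresh t u v : asubst1 (asubst_fresh t u) v = asubst1 t (asubst1 u v).
Proof.
  unfold asubst1, asubst_fresh. rewrite asubst_asubst. f_equal.
  extensionality i; destruct i as [|i]; auto.
Qed.

Lemma asubst1_tup_star i us vs u :
  asubst1 (atup_star i us vs) u = aTup (firstn i us ++ u :: skipn (S i) vs).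
Proof.
  unfold atup_star, asubst1. simpl asubst. f_equal. rewrite map_app. simpl map.
  rewrite !map_map. f_equal; [|f_equal]; rewrite <- map_id; apply map_ext;
    intros a; apply asubst1_alift.
Qed.

Lemma map_ader_tup s Ss t ts :
  map (asubst s) (ader_tup Ss t ts) = ader_tup Ss (asubst (aup s) t) (map (asubst s) ts).
Proof.
  unfold ader_tup. rewrite map_imap, combine_map_r, imap_map. apply imap_ext.
  intros i [T u]. simpl. rewrite asubst_fresh_aup, asubst_tup_star. auto.
Qed.

Lemma map_aint_tup s Ss ts1 ts2 t :
  map (asubst s) (aint_tup Ss ts1 ts2 t) =
  aint_tup Ss (map (asubst s) ts1) (map (asubst s) ts2) (asubst (aup s) t).
Proof.
  unfold aint_tup. rewrite map_imap, combine_map2, combine_map_r, imap_map. apply imap_ext.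
  intros i [T [u v]]. simpl. rewrite asubst_fresh_aup, asubst_tup_star. auto.
Qed.

Lemma map_amul_tup s Ss ts1 ts2 :
  map (asubst s) (amul_tup Ss ts1 ts2) = amul_tup Ss (map (asubst s) ts1) (map (asubst s) ts2).
Proof.
  unfold amul_tup. rewrite combine_map2, combine_map_r, !map_map. apply map_ext.
  intros [T [u v]]. auto.
Qed.

Lemma map_aop_tup s o ts1 ts2 :
  map (asubst s) (aop_tup o ts1 ts2) = aop_tup o (map (asubst s) ts1) (map (asubst s) ts2).
Proof.
  unfold aop_tup. rewrite combine_map2, !map_map. apply map_ext. intros [u v]. auto.
Qed.

Lemma asubst_osum s u us : asubst s (aosum u us) = aosum (asubst s u) (map (asubst s) us).
Proof. unfold aosum. revert u; induction us; simpl; intros; [|rewrite IHus]; auto. Qed.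

(** * Reduction of annotated terms *)

(** An annotation [TBase b] stands for the side condition $t_0:\mathsf B$. Lengths are compared with
    the annotation, so that no component is lost when types and components are combined. The type
    repeated in [r_op_lam] sits in labels, which never reduce, so it does not spoil
    left-linearity. *)
Inductive rule : tm -> tm -> Prop :=
| r_beta T t u : rule (aApp (aLam T t) u) (asubst1 t u)
| r_proj j ts t : nth_error ts j = Some t -> rule (aProj j (aTup ts)) t
| r_case_inl t T1 u1 T2 u2 : rule (aCase (aInj L t) T1 u1 T2 u2) (asubst1 u1 t)
| r_case_inr t T1 u1 T2 u2 : rule (aCase (aInj R t) T1 u1 T2 u2) (asubst1 u2 t)
| r_fix t : rule (aFix t) (aApp t (aFix t))
| r_der_tup b ts t0 :
    rule (aDer (TBase b) (aTup ts) t0) (aTup (map (fun t => aDer (TBase b) t t0) ts))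
| r_der_inj b s t t0 :
    rule (aDer (TBase b) (aInj s t) t0) (aInj s (aDer (TBase b) t t0))
| r_der_lam b T t t0 :
    rule (aDer (TBase b) (aLam T t) t0) (aLam T (aDer (TBase b) (aren swap01 t) (alift t0)))
| r_der_at_tup S1 Ss t ts :
    length ts = length (S1 :: Ss) ->
    rule (aDer (TTup S1 Ss) t (aTup ts)) (aTup (ader_tup (S1 :: Ss) t ts))
| r_int_tup b t1 t2 ts :
    rule (aInt (TBase b) t1 t2 (aTup ts)) (aTup (map (fun t => aInt (TBase b) t1 t2 t) ts))
| r_int_inj b t1 t2 s t :
    rule (aInt (TBase b) t1 t2 (aInj s t)) (aInj s (aInt (TBase b) t1 t2 t))
| r_int_lam b t1 t2 T t :
    rule (aInt (TBase b) t1 t2 (aLam T t))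
         (aLam T (aInt (TBase b) (alift t1) (alift t2) (aren swap01 t)))
| r_int_between_tup S1 Ss ts1 ts2 t u us :
    length ts1 = length (S1 :: Ss) -> length ts2 = length (S1 :: Ss) ->
    aint_tup (S1 :: Ss) ts1 ts2 t = u :: us ->
    rule (aInt (TTup S1 Ss) (aTup ts1) (aTup ts2) t) (aosum u us)
| r_op_tup o ts1 ts2 :
    length ts1 = length ts2 -> rule (aOp o (aTup ts1) (aTup ts2)) (aTup (aop_tup o ts1 ts2))
| r_op_lam o T t1 t2 : rule (aOp o (aLam T t1) (aLam T t2)) (aLam T (aOp o t1 t2))
| r_mul_tup_base b ts t0 :
    rule (aMul (TBase b) (aTup ts) t0) (aTup (map (fun t => aMul (TBase b) t t0) ts))
| r_mul_lam b T t t0 :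
    rule (aMul (TBase b) (aLam T t) t0) (aLam T (aMul (TBase b) t (alift t0)))
| r_mul_inj b s t t0 :
    rule (aMul (TBase b) (aInj s t) t0) (aInj s (aMul (TBase b) t t0))
| r_mul_tup_tup S1 Ss ts1 ts2 u us :
    length ts1 = length (S1 :: Ss) -> length ts2 = length (S1 :: Ss) ->
    amul_tup (S1 :: Ss) ts1 ts2 = u :: us ->
    rule (aMul (TTup S1 Ss) (aTup ts1) (aTup ts2)) (aosum u us).

Inductive astep : tm -> tm -> Prop :=
| astep_rule a b : rule a b -> astep a b
| astep_arg l ts1 t t' ts2 bs :
    astep t t' -> astep (node l (ts1 ++ t :: ts2) bs) (node l (ts1 ++ t' :: ts2) bs)
| astep_body l ts bs1 t t' bs2 :
    astep t t' -> astep (node l ts (bs1 ++ t :: bs2)) (node l ts (bs1 ++ t' :: bs2)).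

Notation asteps := (clos_refl_trans tm astep).

(** The head label and the constructors just below it select the rule: [LDer (TBase b)] inspects
    only the body, [LDer (TTup S1 Ss)] only the point. *)
Lemma rule_det a b b' : rule a b -> rule a b' -> b = b'.
Proof. destruct 1; inversion 1; subst; congruence. Qed.

(** Patterns and side conditions only test labels, positions and lengths, which substitution
    keeps. *)
Lemma rule_asubst s a b : rule a b -> rule (asubst s a) (asubst s b).
Proof.
  destruct 1; simpl asubst; rewrite ?asubst_asubst1, ?asubst_osum.
  - apply r_beta.
  - apply r_proj. apply map_nth_error; auto.
  - apply r_case_inl.
  - apply r_case_inr.
  - apply r_fix.
  - rewrite map_map. generalize (r_der_tup b (map (asubst (aup s)) ts) (asubst s t0)).
    rewrite map_map. auto.
  - apply r_der_inj.
  - rewrite asubst_swap, asubst_aup_alift. apply r_der_lam.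
  - rewrite map_ader_tup. apply r_der_at_tup. rewrite length_map; auto.
  - rewrite map_map. generalize (r_int_tup b (asubst s t1) (asubst s t2) (map (asubst (aup s)) ts)).
    rewrite map_map. auto.
  - apply r_int_inj.
  - rewrite asubst_swap, !asubst_aup_alift. apply r_int_lam.
  - apply r_int_between_tup; rewrite ?length_map; auto.
    rewrite <- map_aint_tup, H1. auto.
  - rewrite map_aop_tup. apply r_op_tup. rewrite !length_map; auto.
  - apply r_op_lam.
  - rewrite map_map. generalize (r_mul_tup_base b (map (asubst s) ts) (asubst s t0)).
    rewrite map_map. auto.
  - rewrite asubst_aup_alift. apply r_mul_lam.
  - apply r_mul_inj.
  - apply r_mul_tup_tup; rewrite ?length_map; auto.
    rewrite <- map_amul_tup, H1. auto.
Qed.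

(** * Confluence *)

(* Parallel reduction in the style of Aczel: the subterms are reduced first, and a
   rule may then be applied to the resulting node. *)
Inductive par : tm -> tm -> Prop :=
| par_var i : par (tvar i) (tvar i)
| par_node l ts ts' bs bs' :
    Forall2 par ts ts' -> Forall2 par bs bs' -> par (node l ts bs) (node l ts' bs')
| par_rule l ts ts' bs bs' b :
    Forall2 par ts ts' -> Forall2 par bs bs' -> rule (node l ts' bs') b ->
    par (node l ts bs) b.

Lemma par_refl a : par a a.
Proof.
  induction a as [i|l ts bs IHt IHb] using tm_nested_ind; [apply par_var|].
  apply par_node; eapply Forall2_refl_on; eauto; simpl; auto.
Qed.

Lemma Forall2_par_refl ts : Forall2 par ts ts.
Proof. induction ts; auto using par_refl. Qed.

(** Lifting a substitution under a binder requires stability of [par] under renaming, itself an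
    instance of the same induction. Abstracting over [Q] allows one proof for both: [Q] is equality
    for renamings, then pointwise [par]. *)
Lemma par_asubst_closed (Q : (nat -> tm) -> (nat -> tm) -> Prop) :
  (forall s s', Q s s' -> forall i, par (s i) (s' i)) ->
  (forall s s', Q s s' -> Q (aup s) (aup s')) ->
  forall a a' s s', par a a' -> Q s s' -> par (asubst s a) (asubst s' a').
Proof.
  intros HQ Hup a.
  induction a as [i|l ts bs IHt IHb] using tm_nested_ind; intros a' s s' Ha Hs.
  - inversion Ha; subst. simpl; auto.
  - inversion Ha as [|? ? ? ? ? ? ?|? ? ? ? ? ? ? ? Hr]; subst; simpl; [apply par_node|].
    3: apply (rule_asubst s') in Hr; eapply par_rule; [| |exact Hr].
    all: apply Forall2_map2; eapply Forall2_mono; eauto; simpl; auto.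
Qed.

Lemma par_aren f a a' : par a a' -> par (aren f a) (aren f a').
Proof.
  rewrite !aren_asubst. intros H.
  apply (par_asubst_closed eq); auto; intros; subst; auto using par_refl.
Qed.

Lemma par_asubst s s' a a' :
  par a a' -> (forall i, par (s i) (s' i)) -> par (asubst s a) (asubst s' a').
Proof.
  apply (par_asubst_closed (fun s s' => forall i, par (s i) (s' i))); auto.
  intros r r' H [|i]; simpl; [apply par_var|]. apply par_aren; auto.
Qed.

Lemma par_asubst1 t t' u u' : par t t' -> par u u' -> par (asubst1 t u) (asubst1 t' u').
Proof. intros; apply par_asubst; auto. intros [|i]; simpl; auto using par_var. Qed.

Lemma par_asubst_fresh t t' u u' :
  par t t' -> par u u' -> par (asubst_fresh t u) (asubst_fresh t' u').
Proof. intros; apply par_asubst; auto. intros [|i]; simpl; auto using par_var. Qed.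

Lemma par_tup_star i us us' vs vs' :
  Forall2 par us us' -> Forall2 par vs vs' -> par (atup_star i us vs) (atup_star i us' vs').
Proof.
  intros Hu Hv. unfold atup_star. apply par_node; auto.
  rewrite <- !firstn_map, <- !skipn_map.
  apply Forall2_splice2; auto using par_var; apply Forall2_map2;
    eapply Forall2_impl; eauto using par_aren.
Qed.

Lemma par_der_tup Ss t t' ts ts' :
  par t t' -> Forall2 par ts ts' -> Forall2 par (ader_tup Ss t ts) (ader_tup Ss t' ts').
Proof.
  intros Ht H. unfold ader_tup. apply Forall2_imap.
  - rewrite !length_combine, (Forall2_length H). auto.
  - intros i [S x] [S' x'] Hx Hx'.
    apply nth_error_combine in Hx as [HS Hx], Hx' as [HS' Hx'].
    replace S' with S by congruence.
    apply par_node; auto using par_asubst_fresh, par_tup_star.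
    constructor; auto. eapply Forall2_nth; eauto.
Qed.

Lemma par_int_tup Ss t t' us us' vs vs' :
  par t t' -> Forall2 par us us' -> Forall2 par vs vs' ->
  Forall2 par (aint_tup Ss us vs t) (aint_tup Ss us' vs' t').
Proof.
  intros Ht Hu Hv. unfold aint_tup. apply Forall2_imap.
  - rewrite !length_combine, (Forall2_length Hu), (Forall2_length Hv). auto.
  - intros i [S [x y]] [S' [x' y']] Hx Hx'.
    apply nth_error_combine in Hx as [HS Hx], Hx' as [HS' Hx'].
    apply nth_error_combine in Hx as [Hx Hy], Hx' as [Hx' Hy'].
    replace S' with S by congruence.
    apply par_node; [constructor; [|constructor; auto] | constructor; auto].
    + eapply (Forall2_nth _ _ _ Hu); eauto.
    + eapply (Forall2_nth _ _ _ Hv); eauto.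
    + apply par_node; auto using par_asubst_fresh, par_tup_star.
Qed.

Lemma par_mul_tup Ss us us' vs vs' :
  Forall2 par us us' -> Forall2 par vs vs' ->
  Forall2 par (amul_tup Ss us vs) (amul_tup Ss us' vs').
Proof.
  unfold amul_tup. intros H; revert Ss vs vs'.
  induction H; intros [|S Ss] vs vs' Hv; simpl; auto; inversion Hv; subst; simpl; auto.
  constructor; auto. apply par_node; auto.
Qed.

Lemma par_op_tup o us us' vs vs' :
  Forall2 par us us' -> Forall2 par vs vs' ->
  Forall2 par (aop_tup o us vs) (aop_tup o us' vs').
Proof.
  unfold aop_tup. intros H; revert vs vs'.
  induction H; intros vs vs' Hv; simpl; auto; inversion Hv; subst; simpl; auto.
  constructor; auto. apply par_node; auto.
Qed.

Lemma par_osum u u' us us' : par u u' -> Forall2 par us us' -> par (aosum u us) (aosum u' us').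
Proof.
  unfold aosum. intros Hu H; revert u u' Hu. induction H; intros; simpl; auto.
  apply IHForall2. apply par_node; auto.
Qed.

Definition constructor_label (l : label) : bool :=
  match l with LLam _ | LTup | LInj _ => true | _ => false end.

Lemma rule_constructor l ts bs b : constructor_label l = true -> ~ rule (node l ts bs) b.
Proof. intros Hl H; inversion H; subst; discriminate. Qed.

Lemma par_constructor l ts bs x :
  par (node l ts bs) x -> constructor_label l = true ->
  exists ts' bs', x = node l ts' bs' /\ Forall2 par ts ts' /\ Forall2 par bs bs'.
Proof.
  intros H Hl; inversion H; subst; eauto 6.
  exfalso; eapply rule_constructor; eauto.
Qed.

Ltac par_inv :=
  repeat match goal with
  | H : Forall2 par (_ :: _) _ |- _ => inversion H; subst; clear H
  | H : Forall2 par [] _ |- _ => inversion H; subst; clear H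
  | H : par (node _ _ _) _ |- _ =>
      apply par_constructor in H; [destruct H as (? & ? & -> & ? & ?) | reflexivity]
  end.

(* Orthogonality: the pattern of a rule only has constructors below its head, and
   no rule applies to a constructor. *)
Lemma rule_par l ts bs b ts' bs' :
  rule (node l ts bs) b -> Forall2 par ts ts' -> Forall2 par bs bs' ->
  exists b', rule (node l ts' bs') b' /\ par b b'.
Proof.
  intros H Ht Hb; inversion H; subst; par_inv;
    repeat match goal with
    | H : Forall2 par ?l _, E : length ?l = _ |- _ => rewrite (Forall2_length H) in E
    | H : Forall2 par ?l _, E : _ = length ?l |- _ => rewrite (Forall2_length H) in E
    end.
  all: try (eexists; split; [constructor; assumption|]).
  all: try (apply par_asubst1; assumption).
  all: repeat first
    [ apply par_node | apply Forall2_cons | apply Forall2_nil | apply par_aren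
    | apply par_der_tup | apply par_op_tup | assumption
    | apply Forall2_map2; eapply Forall2_impl; [|eassumption]; intros ].
  (* Three rules remain: projection, whose contractum is a list element, and the two rules producing
     sums, where the non-empty list of summands has to be exhibited again after the reduction. *)
  - match goal with Hl : Forall2 par _ _, E : nth_error _ _ = _ |- _ =>
      destruct (Forall2_nth_l _ _ _ Hl _ _ E) as (y & Hy & Hxy) end.
    exists y; split; [constructor|]; auto.
  - match goal with
    E : aint_tup ?Ss ?us ?vs ?t = _, Hu : Forall2 par ?us _, Hv : Forall2 par ?vs _,
      Hp : par ?t _ |- _ =>
        generalize (par_int_tup Ss _ _ _ _ _ _ Hp Hu Hv); rewrite E; inversion 1; subst
    end.
    eexists; split; [|apply par_osum; eassumption]. constructor; auto.
  - match goal with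
    E : amul_tup ?Ss ?us ?vs = _, Hu : Forall2 par ?us _, Hv : Forall2 par ?vs _ |- _ =>
        generalize (par_mul_tup Ss _ _ _ _ Hu Hv); rewrite E; inversion 1; subst
    end.
    eexists; split; [|apply par_osum; eassumption]. constructor; auto.
Qed.

Lemma par_list_join (P : tm -> Prop) ts ts1 ts2 :
  (forall a, P a -> forall b c, par a b -> par a c -> exists d, par b d /\ par c d) ->
  Forall P ts -> Forall2 par ts ts1 -> Forall2 par ts ts2 ->
  exists ts3, Forall2 par ts1 ts3 /\ Forall2 par ts2 ts3.
Proof.
  intros HP H; revert ts1 ts2; induction H as [|a ts Ha _ IH]; intros ts1 ts2 H1 H2;
    inversion H1 as [|? b ? ? Hb Hb']; inversion H2 as [|? c ? ? Hc Hc']; subst; eauto.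
  destruct (IH _ _ Hb' Hc') as (ts3 & ? & ?).
  destruct (HP a Ha b c Hb Hc) as (d & ? & ?).
  exists (d :: ts3); auto.
Qed.

(** The children are joined by induction. A root contraction on either side is carried along this
    joining by [rule_par]; if both sides contract the root, they contract the same joined node, and
    [rule_det] makes the results equal. *)
Lemma par_diamond a b c : par a b -> par a c -> exists d, par b d /\ par c d.
Proof.
  revert b c; induction a as [i|l ts bs IHt IHb] using tm_nested_ind; intros b c Hb Hc.
  - inversion Hb; inversion Hc; subst; eauto using par_var.
  - assert (exists ts1 bs1, Forall2 par ts ts1 /\ Forall2 par bs bs1 /\
              (b = node l ts1 bs1 \/ rule (node l ts1 bs1) b)) as (ts1 & bs1 & Ht1 & Hb1 & H1)
      by (inversion Hb; subst; eauto 7).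
    assert (exists ts2 bs2, Forall2 par ts ts2 /\ Forall2 par bs bs2 /\
              (c = node l ts2 bs2 \/ rule (node l ts2 bs2) c)) as (ts2 & bs2 & Ht2 & Hb2 & H2)
      by (inversion Hc; subst; eauto 7).
    destruct (par_list_join _ ts ts1 ts2 (fun a H => H) IHt Ht1 Ht2) as (ts3 & Ht13 & Ht23).
    destruct (par_list_join _ bs bs1 bs2 (fun a H => H) IHb Hb1 Hb2) as (bs3 & Hb13 & Hb23).
    destruct H1 as [-> | H1], H2 as [-> | H2].
    + eauto using par_node.
    + destruct (rule_par _ _ _ _ _ _ H2 Ht23 Hb23) as (d & Hd & Hcd). eauto using par_rule.
    + destruct (rule_par _ _ _ _ _ _ H1 Ht13 Hb13) as (d & Hd & Hcd). eauto using par_rule.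
    + destruct (rule_par _ _ _ _ _ _ H1 Ht13 Hb13) as (d & Hd & Hbd).
      destruct (rule_par _ _ _ _ _ _ H2 Ht23 Hb23) as (d' & Hd' & Hcd).
      rewrite (rule_det _ _ _ Hd' Hd) in Hcd. eauto.
Qed.

Lemma astep_par a b : astep a b -> par a b.
Proof.
  induction 1.
  - destruct a as [i|l ts bs]; [inversion H|]. eauto using par_rule, Forall2_par_refl.
  - apply par_node; auto using Forall2_par_refl, Forall2_app.
  - apply par_node; auto using Forall2_par_refl, Forall2_app.
Qed.

Lemma asteps_args l ts ts' bs :
  Forall2 asteps ts ts' -> asteps (node l ts bs) (node l ts' bs).
Proof.
  (* The prefix [pre], initially empty, collects the arguments already reduced. *)
  intros H. change (asteps (node l ([] ++ ts) bs) (node l ([] ++ ts') bs)).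
  generalize (@nil tm) as pre. induction H as [|t t' ts ts' Ht _ IH]; intros pre.
  - apply rt_refl.
  - apply rt_trans with (node l (pre ++ t' :: ts) bs).
    + clear - Ht. induction Ht; eauto using rt_refl, rt_trans, rt_step, astep_arg.
    + generalize (IH (pre ++ [t'])). rewrite <- !app_assoc. auto.
Qed.

Lemma asteps_bodies l ts bs bs' :
  Forall2 asteps bs bs' -> asteps (node l ts bs) (node l ts bs').
Proof.
  intros H. change (asteps (node l ts ([] ++ bs)) (node l ts ([] ++ bs'))).
  generalize (@nil tm) as pre. induction H as [|t t' bs bs' Ht _ IH]; intros pre.
  - apply rt_refl.
  - apply rt_trans with (node l ts (pre ++ t' :: bs)).
    + clear - Ht. induction Ht; eauto using rt_refl, rt_trans, rt_step, astep_body.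
    + generalize (IH (pre ++ [t'])). rewrite <- !app_assoc. auto.
Qed.

Lemma par_asteps a b : par a b -> asteps a b.
Proof.
  revert b; induction a as [i|l ts bs IHt IHb] using tm_nested_ind; intros b H.
  - inversion H; subst. apply rt_refl.
  - assert (Hc : forall ts' bs', Forall2 par ts ts' -> Forall2 par bs bs' ->
                 asteps (node l ts bs) (node l ts' bs')).
    { intros ts' bs' Ht Hb. apply rt_trans with (node l ts' bs).
      - apply asteps_args. exact (Forall2_mono _ _ _ _ _ IHt (fun x y HP => HP y) Ht).
      - apply asteps_bodies. exact (Forall2_mono _ _ _ _ _ IHb (fun x y HP => HP y) Hb). }
    inversion H; subst; eauto using rt_trans, rt_step, astep_rule.
Qed.

Lemma par_strip a b c :
  par a b -> clos_refl_trans_1n tm par a c ->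
  exists d, clos_refl_trans_1n tm par b d /\ par c d.
Proof.
  intros Hb Hc; revert b Hb; induction Hc as [|a a' c Ha _ IH]; intros b Hb.
  - exists b; split; [apply Relation_Operators.rt1n_refl | exact Hb].
  - destruct (par_diamond _ _ _ Hb Ha) as (d & Hbd & Had).
    destruct (IH _ Had) as (e & Hde & Hce).
    exists e; split; [eapply Relation_Operators.rt1n_trans|]; eassumption.
Qed.

(** [par] lies between [astep] and [asteps], so both have the same reflexive transitive closure, and
    the diamonds of [par] tile the diagram. *)
Lemma asteps_confluent a b c :
  asteps a b -> asteps a c -> exists d, asteps b d /\ asteps c d.
Proof.
  assert (H1 : forall a b, asteps a b -> clos_refl_trans_1n tm par a b).
  { intros x y H. apply clos_rt_rt1n.
    induction H; eauto using rt_refl, rt_trans, rt_step, astep_par. }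
  assert (H2 : forall a b, clos_refl_trans_1n tm par a b -> asteps a b).
  { intros x y H. induction H; eauto using rt_refl, rt_trans, par_asteps. }
  intros Hb Hc. apply H1 in Hb, Hc.
  assert (exists d, clos_refl_trans_1n tm par b d /\ clos_refl_trans_1n tm par c d)
    as (d & ? & ?); [|eauto].
  revert c Hc; induction Hb as [|a a' b Ha _ IH]; intros c Hc.
  - exists c; split; [exact Hc | apply Relation_Operators.rt1n_refl].
  - destruct (par_strip _ _ _ Ha Hc) as (e & Hae & Hce).
    destruct (IH _ Hae) as (d & Hbd & Hed).
    exists d; split; [|eapply Relation_Operators.rt1n_trans]; eassumption.
Qed.

(** * Typing of annotated terms *)

(* [lty fx l Ts Bs T]: a node labelled by l has type T when its subterms under no
   binder have the types Ts, and those under a binder have, for (S, U) in Bs, the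
   type U under a variable of type S.  Fixpoints are only allowed if [fx]. *)
Inductive lty (fx : bool) : label -> list typ -> list (typ * typ) -> typ -> Prop :=
| lty_cst c : lty fx (LCst c) [] [] (const_ty Sg c)
| lty_lam S T : lty fx (LLam S) [] [(S, T)] (TArr S T)
| lty_app S T : lty fx LApp [TArr S T; S] [] T
| lty_tup T1 Ts : lty fx LTup (T1 :: Ts) [] (TTup T1 Ts)
| lty_proj j T1 Ts T :
    nth_error (T1 :: Ts) j = Some T -> lty fx (LProj j) [TTup T1 Ts] [] T
| lty_op o T : addable T -> lty fx (LOp o) [T; T] [] T
| lty_mul S T D : addable T -> dty T S D -> lty fx (LMul S) [D; S] [] T
| lty_der S T D : dty T S D -> lty fx (LDer S) [S] [(S, T)] D
| lty_int S T D : addable T -> dty T S D -> lty fx (LInt S) [S; S] [(S, D)] T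
| lty_inl T1 T2 : lty fx (LInj L) [T1] [] (TSum T1 T2)
| lty_inr T1 T2 : lty fx (LInj R) [T2] [] (TSum T1 T2)
| lty_case T1 T2 T : lty fx (LCase T1 T2) [TSum T1 T2] [(T1, T); (T2, T)] T
| lty_fix T : fx = true -> lty fx LFix [TArr T T] [] T.

(** Every rule but that of variables is delegated to [lty], so that inductions on terms have a
    single case for nodes. *)
Inductive atype (fx : bool) : ctx Sg -> tm -> typ -> Prop :=
| atype_var G i T : nth_error G i = Some T -> atype fx G (tvar i) T
| atype_node G l ts bs Ts Bs T :
    lty fx l Ts Bs T -> Forall2 (atype fx G) ts Ts ->
    Forall2 (fun b B => atype fx (fst B :: G) b (snd B)) bs Bs ->
    atype fx G (node l ts bs) T.

(** Same scheme as [par_asubst_closed]: [Q] is instantiated with renamings, then with arbitrary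
    typed substitutions. *)
Lemma atype_asubst_closed fx (Q : ctx Sg -> ctx Sg -> (nat -> tm) -> Prop) :
  (forall G G' s, Q G G' s -> forall i T, nth_error G i = Some T -> atype fx G' (s i) T) ->
  (forall G G' s S, Q G G' s -> Q (S :: G) (S :: G') (aup s)) ->
  forall a G G' s T, atype fx G a T -> Q G G' s -> atype fx G' (asubst s a) T.
Proof.
  intros HQ Hup a.
  induction a as [i|l ts bs IHt IHb] using tm_nested_ind; intros G G' s T Ha Hs;
    inversion Ha as [|? ? ? ? Ts Bs ? Hl Ht Hb]; subst; simpl; eauto.
  eapply atype_node; [exact Hl| |]; apply Forall2_map_l.
  - refine (Forall2_mono _ _ _ _ _ IHt _ Ht); simpl; eauto.
  - refine (Forall2_mono _ _ _ _ _ IHb _ Hb); simpl; eauto.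
Qed.

Lemma atype_aren fx f a G G' T :
  atype fx G a T ->
  (forall i T, nth_error G i = Some T -> nth_error G' (f i) = Some T) ->
  atype fx G' (aren f a) T.
Proof.
  rewrite aren_asubst. intros Ha Hf.
  apply (atype_asubst_closed fx (fun G G' s => forall i T, nth_error G i = Some T ->
    exists k, s i = tvar k /\ nth_error G' k = Some T)) with (G := G); eauto.
  - intros H H' s Hs i U Hi. destruct (Hs i U Hi) as (k & -> & Hk). apply atype_var; auto.
  - intros H H' s S Hs [|i] U Hi; simpl in *; [exists 0; auto|].
    destruct (Hs i U Hi) as (k & -> & Hk). exists (Datatypes.S k); auto.
Qed.

Lemma atype_alift fx G S a T : atype fx G a T -> atype fx (S :: G) (alift a) T.
Proof. intros; eapply atype_aren; eauto. Qed.

Lemma atype_asubst fx s a G G' T :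
  atype fx G a T ->
  (forall i T, nth_error G i = Some T -> atype fx G' (s i) T) ->
  atype fx G' (asubst s a) T.
Proof.
  intros Ha Hs.
  apply (atype_asubst_closed fx (fun G G' s => forall i T, nth_error G i = Some T ->
    atype fx G' (s i) T)) with (G := G); auto.
  intros H H' r S Hr [|i] U Hi; simpl in *; [apply atype_var | apply atype_alift]; auto.
Qed.

Lemma atype_asubst1 fx G S t u T :
  atype fx (S :: G) t T -> atype fx G u S -> atype fx G (asubst1 t u) T.
Proof.
  intros Ht Hu. eapply atype_asubst; eauto.
  intros [|i] U Hi; simpl in *; [congruence | apply atype_var; auto].
Qed.

Lemma atype_swap fx G S U t T :
  atype fx (S :: U :: G) t T -> atype fx (U :: S :: G) (aren swap01 t) T.
Proof. intros Ht. eapply atype_aren; eauto. intros [|[|i]]; auto. Qed.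

Lemma atype_fresh fx G S U t u T :
  atype fx (S :: G) t T -> atype fx (U :: G) u S -> atype fx (U :: G) (asubst_fresh t u) T.
Proof.
  intros Ht Hu. eapply atype_asubst; eauto.
  intros [|i] W Hi; simpl in *; [congruence | apply atype_var; auto].
Qed.

Lemma atype_tup fx G ts S1 Ss :
  Forall2 (atype fx G) ts (S1 :: Ss) -> atype fx G (aTup ts) (TTup S1 Ss).
Proof. intros; eapply atype_node; eauto using lty_tup. Qed.

Lemma Forall2_flip {A B} (R : A -> B -> Prop) l l' :
  Forall2 R l l' -> Forall2 (fun y x => R x y) l' l.
Proof. induction 1; auto. Qed.

Lemma atype_tup_star fx G us vs S1 Ss i S :
  Forall2 (atype fx G) us (S1 :: Ss) -> Forall2 (atype fx G) vs (S1 :: Ss) ->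
  nth_error (S1 :: Ss) i = Some S -> atype fx (S :: G) (atup_star i us vs) (TTup S1 Ss).
Proof.
  intros Hu Hv Hi. apply atype_tup.
  rewrite <- firstn_map, <- skipn_map.
  apply Forall2_flip, Forall2_splice with (x := S); auto.
  - apply Forall2_flip, Forall2_map_l. eapply Forall2_impl; eauto using atype_alift.
  - apply Forall2_flip, Forall2_map_l. eapply Forall2_impl; eauto using atype_alift.
  - apply atype_var; auto.
Qed.

Lemma atype_osum fx G u us T :
  addable T -> atype fx G u T -> Forall (fun u => atype fx G u T) us ->
  atype fx G (aosum u us) T.
Proof.
  intros HT Hu H; revert u Hu. induction H; intros; simpl; auto.
  apply IHForall. eapply atype_node; [apply lty_op; auto| |]; auto.
Qed.

Lemma atype_der fx G S t t0 T D :
  dty T S D -> atype fx (S :: G) t T -> atype fx G t0 S -> atype fx G (aDer S t t0) D.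
Proof. intros; eapply atype_node; [eapply lty_der; eauto| |]; auto. Qed.

Lemma atype_int fx G S t1 t2 t T D :
  addable T -> dty T S D -> atype fx G t1 S -> atype fx G t2 S ->
  atype fx (S :: G) t D -> atype fx G (aInt S t1 t2 t) T.
Proof. intros; eapply atype_node; [eapply lty_int; eauto| |]; auto. Qed.

Lemma atype_mul fx G S t u T D :
  addable T -> dty T S D -> atype fx G t D -> atype fx G u S -> atype fx G (aMul S t u) T.
Proof. intros; eapply atype_node; [eapply lty_mul; eauto| |]; auto. Qed.

Lemma atype_lam fx G S t T : atype fx (S :: G) t T -> atype fx G (aLam S t) (TArr S T).
Proof. intros; eapply atype_node; [eapply lty_lam; eauto| |]; auto. Qed.

Lemma atype_inj fx G s t T1 T2 :
  atype fx G t (match s with L => T1 | R => T2 end) -> atype fx G (aInj s t) (TSum T1 T2).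
Proof.
  intros; destruct s; (eapply atype_node; [constructor| |]; auto).
Qed.

Lemma atype_der_tup fx G Ss Ds S1 S1s t ts T :
  Forall2 (dty T) Ss Ds -> Ss = S1 :: S1s -> atype fx (TTup S1 S1s :: G) t T ->
  Forall2 (atype fx G) ts Ss -> Forall2 (atype fx G) (ader_tup Ss t ts) Ds.
Proof.
  intros HD -> Ht Hts. apply Forall2_imap_l.
  - rewrite length_combine, (Forall2_length Hts), (Forall2_length HD). lia.
  - intros i [S u] D Hi HDi. apply nth_error_combine in Hi as [HS Hu].
    pose proof (Forall2_nth _ _ _ Hts _ _ _ Hu HS).
    pose proof (Forall2_nth _ _ _ HD _ _ _ HS HDi).
    eapply atype_der; eauto using atype_fresh, atype_tup_star.
Qed.

(** Projecting the body to its i-th component leaves the type $\partial T/\partial S_i$, and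
    integrating this over $S_i$ gives back [T]. *)
Lemma atype_int_tup fx G S1 Ss D1 Ds t ts1 ts2 T :
  addable T -> Forall2 (dty T) (S1 :: Ss) (D1 :: Ds) ->
  atype fx (TTup S1 Ss :: G) t (TTup D1 Ds) ->
  Forall2 (atype fx G) ts1 (S1 :: Ss) -> Forall2 (atype fx G) ts2 (S1 :: Ss) ->
  Forall (fun u => atype fx G u T) (aint_tup (S1 :: Ss) ts1 ts2 t).
Proof.
  intros HT HD Ht H1 H2. apply Forall_imap. intros i [S [u v]] Hx.
  apply nth_error_combine in Hx as [HS Hx].
  apply nth_error_combine in Hx as [Hu Hv].
  destruct (Forall2_nth_l _ _ _ HD _ _ HS) as (D & HDn & HDD).
  eapply atype_int; eauto.
  - exact (Forall2_nth _ _ _ H1 _ _ _ Hu HS).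
  - exact (Forall2_nth _ _ _ H2 _ _ _ Hv HS).
  - eapply atype_node; [eapply lty_proj; eassumption| |auto].
    constructor; auto. eapply atype_fresh; eauto using atype_tup_star.
Qed.

Lemma atype_mul_tup fx G Ss Ds ts1 ts2 T :
  addable T -> Forall2 (dty T) Ss Ds ->
  Forall2 (atype fx G) ts1 Ds -> Forall2 (atype fx G) ts2 Ss ->
  Forall (fun u => atype fx G u T) (amul_tup Ss ts1 ts2).
Proof.
  intros HT HD; revert ts1 ts2.
  induction HD; intros ts1 ts2 H1 H2; inversion H1; inversion H2; subst; constructor.
  - eapply atype_mul; eauto.
  - apply IHHD; auto.
Qed.

Lemma atype_op_tup fx G o ts1 ts2 Ts :
  Forall addable Ts -> Forall2 (atype fx G) ts1 Ts -> Forall2 (atype fx G) ts2 Ts ->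
  Forall2 (atype fx G) (aop_tup o ts1 ts2) Ts.
Proof.
  intros HT H1; revert ts2.
  induction H1; intros ts2 H2; inversion H2; inversion HT; subst; constructor.
  - eapply atype_node; [eapply lty_op; eauto| |]; auto.
  - apply IHForall2; auto.
Qed.

Lemma dty_base_inv (T : typ) b D : dty T (TBase b) D -> D = T.
Proof. inversion 1; auto. Qed.

Lemma dty_tup_inv (T : typ) S1 Ss D :
  dty T (TTup S1 Ss) D ->
  exists D1 Ds, D = TTup D1 Ds /\ Forall2 (dty T) (S1 :: Ss) (D1 :: Ds).
Proof. inversion 1; eauto. Qed.

Lemma addable_arr_inv (S T : typ) : addable (TArr S T) -> addable T.
Proof. inversion 1; auto. Qed.

Lemma addable_tup_inv (S : typ) Ss : addable (TTup S Ss) -> Forall addable (S :: Ss).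
Proof. inversion 1; auto. Qed.

Ltac atype_inv :=
  repeat match goal with
  | H : atype _ _ (node _ _ _) _ |- _ => inversion H; subst; clear H
  | H : lty _ _ _ _ _ |- _ => inversion H; subst; clear H
  | H : Forall2 (atype _ _) (_ :: _) _ |- _ => inversion H; subst; clear H
  | H : Forall2 _ (_ :: _) ((_, _) :: _) |- _ => inversion H; subst; clear H
  | H : Forall2 _ [] _ |- _ => inversion H; subst; clear H
  | H : Forall2 _ _ [] |- _ => inversion H; subst; clear H
  | H : dty _ (TBase _) _ |- _ => apply dty_base_inv in H; subst
  | H : dty _ (TTup _ _) _ |- _ =>
      let E := fresh in
      apply dty_tup_inv in H as (? & ? & E & ?); first [injection E as ? ? | idtac]; subst
  | H : addable (TSum _ _) |- _ => inversion H
  end; simpl fst in *; simpl snd in *; subst.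

Lemma rule_preservation fx G a b T : rule a b -> atype fx G a T -> atype fx G b T.
Proof.
  intros Hr Ha; destruct Hr; atype_inv.
  all: try (eapply atype_asubst1; eassumption).
  all: try solve [eauto 7 using atype_lam, atype_inj, atype_der, atype_int, atype_mul, atype_alift,
    atype_swap, dty_base, addable_arr_inv].
  all: try match goal with H : addable (TSum _ _) |- _ => inversion H end.
  all: try apply atype_tup.
  - match goal with H : Forall2 _ ts _ |- _ => eapply (Forall2_nth _ _ _ H);
      eassumption end.
  - eapply atype_node; [apply lty_app| |auto].
    constructor; [eassumption|]. constructor; auto.
    eapply atype_node; [apply lty_fix; auto| |]; auto.
  - apply Forall2_map_l. eapply Forall2_impl; [|eassumption].
    eauto using atype_der, dty_base.
  - eapply atype_der_tup; eauto.
  (* Addability is known for the list of types, while [Forall2_mono] takes its extra hypothesis on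
     the first list; hence the flips. *)
  - apply Forall2_map_l, Forall2_flip.
    match goal with H : addable _ |- _ => apply addable_tup_inv in H;
      refine (Forall2_mono _ _ _ _ _ H _ (Forall2_flip _ _ _ ltac:(eassumption))) end.
    eauto using atype_int, dty_base.
  - assert (Hu : Forall (fun u => atype fx G u T) (u :: us))
      by (match goal with E : _ = u :: us |- _ => rewrite <- E end;
          eapply atype_int_tup; eassumption).
    inversion Hu; subst. apply atype_osum; auto.
  - eapply atype_op_tup; eauto using addable_tup_inv.
  - apply atype_lam. eapply atype_node; [apply lty_op| |auto]; eauto using addable_arr_inv.
  - apply Forall2_map_l, Forall2_flip.
    match goal with H : addable _ |- _ => apply addable_tup_inv in H;
      refine (Forall2_mono _ _ _ _ _ H _ (Forall2_flip _ _ _ ltac:(eassumption))) end.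
    eauto using atype_mul, dty_base.
  - assert (Hu : Forall (fun u => atype fx G u T) (u :: us))
      by (match goal with E : _ = u :: us |- _ => rewrite <- E end;
          eapply atype_mul_tup; eassumption).
    inversion Hu; subst. apply atype_osum; auto.
Qed.

Lemma Forall2_replace {A B} (R : A -> B -> Prop) xs1 x x' xs2 ys :
  Forall2 R (xs1 ++ x :: xs2) ys -> (forall y, R x y -> R x' y) ->
  Forall2 R (xs1 ++ x' :: xs2) ys.
Proof.
  revert ys; induction xs1; intros ys H Hx; inversion H; subst; simpl; auto.
Qed.

Lemma preservation fx G a b T : astep a b -> atype fx G a T -> atype fx G b T.
Proof.
  intros H; revert G T; induction H; intros G T Ha.
  - eapply rule_preservation; eauto.
  - inversion Ha; subst. eapply atype_node; eauto using Forall2_replace.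
  - inversion Ha; subst. eapply atype_node; eauto.
    eapply Forall2_replace; [eassumption|]. simpl; auto.
Qed.

(** * Erasure of annotations *)

(* Ill-formed nodes, which are not typable, are sent to the untypable empty tuple. *)
Fixpoint erase (a : tm) : term Sg :=
  match a with
  | tvar i => Var i
  | node l ts bs =>
      match l, map erase ts, map erase bs with
      | LCst c, _, _ => Cst c
      | LLam T, _, [t] => Lam T t
      | LApp, [t; u], _ => App t u
      | LTup, ts, _ => Tup ts
      | LProj j, [t], _ => Proj j t
      | LOp o, [t; u], _ => Op o t u
      | LMul _, [t; u], _ => Mul t u
      | LDer _, [t0], [t] => Der t t0
      | LInt _, [t1; t2], [t] => Int t1 t2 t
      | LInj s, [t], _ => Inj s t
      | LCase T1 T2, [t], [u1; u2] => Case t T1 u1 T2 u2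
      | LFix, [t], _ => Fix t
      | _, _, _ => Tup []
      end
  end.

Ltac split_lists ts bs :=
  destruct ts as [|? [|? [|? ?]]]; simpl; auto; destruct bs as [|? [|? [|? ?]]]; simpl; auto;
  repeat match goal with H : Forall _ (_ :: _) |- _ => inversion H; subst; clear H end.

Lemma erase_aren f a : erase (aren f a) = ren f (erase a).
Proof.
  revert f; induction a as [i|l ts bs IHt IHb] using tm_nested_ind; intros f; simpl; auto.
  destruct l; auto.
  (* Tuples are treated apart, being the only nodes whose number of subterms is not fixed by the
     label. *)
  3: { simpl. f_equal. rewrite !map_map. apply map_ext_Forall. eapply Forall_impl, IHt; auto. }
  all: split_lists ts bs; f_equal; auto.
Qed.

Lemma erase_asubst s a : erase (asubst s a) = subst (fun i => erase (s i)) (erase a).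
Proof.
  revert s; induction a as [i|l ts bs IHt IHb] using tm_nested_ind; intros s; simpl; auto.
  assert (Hup : (fun i => erase (aup s i)) = up (fun i => erase (s i))).
  { extensionality i; destruct i as [|i]; simpl; auto. apply erase_aren. }
  destruct l; auto.
  3: { simpl. f_equal. rewrite !map_map. apply map_ext_Forall. eapply Forall_impl, IHt; auto. }
  all: split_lists ts bs; rewrite <- ?Hup; f_equal; auto.
Qed.

Lemma erase_asubst1 t u : erase (asubst1 t u) = subst1 (erase t) (erase u).
Proof.
  unfold asubst1, subst1. rewrite erase_asubst. f_equal.
  extensionality i; destruct i; auto.
Qed.

Lemma erase_fresh t u : erase (asubst_fresh t u) = subst_fresh (erase t) (erase u).
Proof.
  unfold asubst_fresh, subst_fresh. rewrite erase_asubst. f_equal.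
  extensionality i; destruct i; auto.
Qed.

Lemma erase_tup_star i us vs :
  erase (atup_star i us vs) = tup_star i (map erase us) (map erase vs).
Proof.
  unfold atup_star, tup_star. cbn -[skipn]. rewrite map_app, firstn_map.
  cbn -[skipn]. rewrite skipn_map, !map_map.
  f_equal. f_equal; [|f_equal]; apply map_ext; intros a; apply erase_aren.
Qed.

Lemma map_snd_combine {A B} (l : list A) (l' : list B) :
  length l = length l' -> map snd (combine l l') = l'.
Proof.
  revert l'; induction l; intros [|b l'] H; try discriminate; simpl; auto.
  f_equal; auto.
Qed.

Lemma imap_combine_snd {A B D} (f : nat -> B -> D) k (l : list A) l' :
  length l' = length l -> imap (fun i p => f i (snd p)) k (combine l l') = imap f k l'.
Proof. intros H. rewrite <- (imap_map f snd), map_snd_combine; auto. Qed.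

Lemma erase_der_tup Ss t ts :
  length ts = length Ss -> map erase (ader_tup Ss t ts) = der_tup (erase t) (map erase ts).
Proof.
  intros Hl. unfold ader_tup, der_tup. rewrite map_combine_seq, map_imap, imap_map.
  rewrite <- (imap_combine_snd _ 0 Ss ts) by auto. apply imap_ext.
  intros i [S u]. simpl. rewrite erase_fresh, erase_tup_star. auto.
Qed.

Lemma erase_int_tup Ss ts1 ts2 t :
  length ts1 = length Ss -> length ts2 = length Ss ->
  map erase (aint_tup Ss ts1 ts2 t) = int_tup (map erase ts1) (map erase ts2) (erase t).
Proof.
  intros H1 H2. unfold aint_tup, int_tup.
  replace (length (map erase ts1)) with (length (combine (map erase ts1) (map erase ts2)))
    by (rewrite length_combine, !length_map; lia).
  rewrite map_combine_seq, map_imap, combine_map2, imap_map.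
  rewrite <- (imap_combine_snd _ 0 Ss (combine ts1 ts2)) by (rewrite length_combine; lia).
  apply imap_ext.
  intros i [S [u v]]. simpl. rewrite erase_fresh, erase_tup_star. auto.
Qed.

Lemma erase_mul_tup Ss ts1 ts2 :
  length ts1 = length Ss -> length ts2 = length Ss ->
  map erase (amul_tup Ss ts1 ts2) = zip_with (@Mul Sg) (map erase ts1) (map erase ts2).
Proof.
  intros H1 H2. unfold amul_tup, zip_with.
  rewrite combine_map2, !map_map.
  rewrite <- (map_snd_combine Ss (combine ts1 ts2)) at 2 by (rewrite length_combine; lia).
  rewrite map_map. apply map_ext. intros [S [u v]]. auto.
Qed.

Lemma erase_op_tup o ts1 ts2 :
  map erase (aop_tup o ts1 ts2) = zip_with (@Op Sg o) (map erase ts1) (map erase ts2).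
Proof.
  unfold aop_tup, zip_with. rewrite combine_map2, !map_map. apply map_ext. intros [u v]. auto.
Qed.

Lemma erase_osum u us : erase (aosum u us) = osum (erase u) (map erase us).
Proof. unfold aosum, osum. revert u; induction us; simpl; intros; [|rewrite IHus]; auto. Qed.

Lemma erase_atype fx a G T : atype fx G a T -> has_type G (erase a) T.
Proof.
  revert G T; induction a as [i|l ts bs IHt IHb] using tm_nested_ind; intros G T Ha;
    inversion Ha as [|? ? ? ? Ts Bs ? Hl Ht Hb]; subst; simpl.
  - apply ty_var; auto.
  - apply (Forall2_mono _ _ (fun t T => has_type G (erase t) T) _ _ IHt (fun a T IH => IH G T))
      in Ht.
    apply (Forall2_mono _ _ (fun b B => has_type (fst B :: G) (erase b) (snd B)) _ _ IHb
      (fun a T IH => IH _ _)) in Hb.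
    destruct Hl.
    4: { apply ty_tup. apply Forall2_map_l. auto. }
    all: repeat match goal with
      | H : Forall2 _ _ (_ :: _) |- _ => inversion H; subst; clear H
      | H : Forall2 _ _ [] |- _ => inversion H; subst; clear H
      end; simpl in *; econstructor; eauto.
Qed.

(** * Annotating typed terms *)

Fixpoint term_nested_ind (P : term Sg -> Prop)
    (Hc : forall c, P (Cst c)) (Hv : forall i, P (Var i))
    (Hl : forall T t, P t -> P (Lam T t)) (Ha : forall t u, P t -> P u -> P (App t u))
    (Ht : forall ts, Forall P ts -> P (Tup ts)) (Hp : forall j t, P t -> P (Proj j t))
    (Ho : forall o t u, P t -> P u -> P (Op o t u))
    (Hm : forall t u, P t -> P u -> P (Mul t u))
    (Hd : forall t t0, P t -> P t0 -> P (Der t t0))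
    (Hi : forall t1 t2 t, P t1 -> P t2 -> P t -> P (Int t1 t2 t))
    (Hj : forall s t, P t -> P (Inj s t))
    (Hs : forall t T1 u1 T2 u2, P t -> P u1 -> P u2 -> P (Case t T1 u1 T2 u2))
    (Hf : forall t, P t -> P (Fix t)) (t : term Sg) : P t :=
  let ind := term_nested_ind P Hc Hv Hl Ha Ht Hp Ho Hm Hd Hi Hj Hs Hf in
  match t with
  | Cst c => Hc c
  | Var i => Hv i
  | Lam T t => Hl T t (ind t)
  | App t u => Ha t u (ind t) (ind u)
  | Tup ts =>
      Ht ts ((fix all ts : Forall P ts :=
        match ts with
        | [] => Forall_nil P
        | t :: ts => Forall_cons t (ind t) (all ts)
        end) ts)
  | Proj j t => Hp j t (ind t)
  | Op o t u => Ho o t u (ind t) (ind u)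
  | Mul t u => Hm t u (ind t) (ind u)
  | Der t t0 => Hd t t0 (ind t) (ind t0)
  | Int t1 t2 t => Hi t1 t2 t (ind t1) (ind t2) (ind t)
  | Inj s t => Hj s t (ind t)
  | Case t T1 u1 T2 u2 => Hs t T1 u1 T2 u2 (ind t) (ind u1) (ind u2)
  | Fix t => Hf t (ind t)
  end.

(** The annotations are read off the typing derivation. With [fx = true] the condition on fixpoints
    is vacuous; with [fx = false] it confines the annotated term to the system without [LFix], as
    normalization requires. *)
Lemma elaboration fx t G T :
  has_type G t T -> (fx = false -> fix_free t = true) ->
  exists a, atype fx G a T /\ erase a = t.
Proof.
  revert G T; induction t using term_nested_ind; intros G A HA Hfx;
    inversion HA; subst; simpl in Hfx;
    repeat match goal with
    | IH : forall G T, has_type G ?t T -> (_ -> _) -> _, H : has_type _ ?t _ |- _ =>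
        let a := fresh "a" in
        destruct (IH _ _ H) as (a & ? & <-);
        [ intros E; specialize (Hfx E); rewrite ?Bool.andb_true_iff in Hfx; tauto || discriminate
        | clear H ]
    end.
  - exists (node (LCst c) [] []). split; auto. eapply atype_node; auto using lty_cst.
  - exists (tvar i). split; auto. apply atype_var; auto.
  - exists (aLam T a). split; auto. apply atype_lam; auto.
  - exists (aApp a0 a). split; auto. eapply atype_node; [apply lty_app| |]; eauto.
  - assert (exists us, Forall2 (atype fx G) us (T1 :: Ts) /\ map erase us = ts)
      as (us & Hus & <-).
    { clear HA. revert H2. generalize (T1 :: Ts) as Us. intros Us H1.
      induction H1 as [|t U ts Us HtU _ IH]; [exists []; auto|].
      inversion H as [|? ? Hind]; subst. simpl in Hfx.
      destruct (Hind _ _ HtU) as (a & Ha & <-).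
      { intros E; specialize (Hfx E); rewrite ?Bool.andb_true_iff in Hfx; tauto. }
      destruct IH as (us & Hus & <-); auto.
      { intros E; specialize (Hfx E); rewrite ?Bool.andb_true_iff in Hfx; tauto. }
      exists (a :: us); auto. }
    exists (aTup us). split; auto. apply atype_tup; auto.
  - exists (aProj j a). split; auto. eapply atype_node; [eapply lty_proj; eassumption| |]; auto.
  - exists (aOp o a0 a). split; auto. eapply atype_node; [eapply lty_op; eauto| |]; auto.
  - exists (aMul S a0 a). split; auto. eapply atype_mul; eauto.
  - exists (aDer S a a0). split; auto. eapply atype_der; eauto.
  - exists (aInt S a1 a0 a). split; auto. eapply atype_int; eauto.
  - exists (aInj L a). split; auto. apply atype_inj; auto.
  - exists (aInj R a). split; auto. apply atype_inj; auto.
  - exists (aCase a1 T1 a0 T2 a). split; auto. eapply atype_node; [apply lty_case| |]; auto.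
  - exists (aFix a). split; auto. eapply atype_node; [apply lty_fix| |]; auto.
    destruct fx; auto; discriminate (Hfx eq_refl).
Qed.

(** * Uniqueness of types up to sums *)

Fixpoint ty_nested_ind (P : typ -> Prop) (Hb : forall b, P (TBase b))
    (Ht : forall T1 Ts, Forall P (T1 :: Ts) -> P (TTup T1 Ts))
    (Ha : forall S T, P S -> P T -> P (TArr S T))
    (Hs : forall T1 T2, P T1 -> P T2 -> P (TSum T1 T2)) (T : typ) : P T :=
  let ind := ty_nested_ind P Hb Ht Ha Hs in
  match T with
  | TBase b => Hb b
  | TTup T1 Ts =>
      Ht T1 Ts (Forall_cons T1 (ind T1) ((fix all Ts : Forall P Ts :=
        match Ts with
        | [] => Forall_nil P
        | T :: Ts => Forall_cons T (ind T) (all Ts)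
        end) Ts))
  | TArr A B => Ha A B (ind A) (ind B)
  | TSum T1 T2 => Hs T1 T2 (ind T1) (ind T2)
  end.

(* Injections make the types of a term ambiguous, but only below sums.  A type at
   which derivatives are taken has no sums, hence is determined. *)
Inductive same_ty : typ -> typ -> Prop :=
| same_base b : same_ty (TBase b) (TBase b)
| same_tup T1 Ts U1 Us :
    Forall2 same_ty (T1 :: Ts) (U1 :: Us) -> same_ty (TTup T1 Ts) (TTup U1 Us)
| same_arr S S' T T' : same_ty T T' -> same_ty (TArr S T) (TArr S' T')
| same_sum T1 T2 U1 U2 : same_ty (TSum T1 T2) (TSum U1 U2).

Lemma same_refl T : same_ty T T.
Proof.
  induction T using ty_nested_ind; try (constructor; assumption).
  apply same_tup. eapply Forall2_refl_on; eauto; simpl; auto.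
Qed.

(** Differentiability builds [S] from base types and tuples alone, and on such types [same_ty] is
    equality. *)
Lemma same_point S S' T D : same_ty S S' -> dty T S D -> S = S'.
Proof.
  revert S' D; induction S as [b|S1 Ss IH| |] using ty_nested_ind; intros S' D HS HD;
    inversion HD as [|? ? ? ? HD1]; subst; inversion HS as [|? ? ? ? HS1| |]; subst; auto.
  cut (S1 :: Ss = U1 :: Us); [congruence|].
  revert HD1 HS1 IH. generalize (S1 :: Ss), (D1 :: Ds), (U1 :: Us).
  intros l l' l'' H. revert l''. clear - H.
  induction H; intros l'' H' IH; inversion H'; inversion IH; subst; auto.
  f_equal; eauto.
Qed.

Lemma same_derivative S T T' D D' :
  dty T S D -> dty T' S D' -> same_ty T T' -> same_ty D D'.
Proof.
  intros HD HD' HT. revert D D' HD HD'.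
  induction S as [b|S1 Ss IH| |] using ty_nested_ind; intros D D' HD HD';
    inversion HD as [|? ? ? ? HD1]; subst; inversion HD' as [|? ? ? ? HD2]; subst; auto.
  apply same_tup. revert HD1 HD2 IH.
  generalize (S1 :: Ss), (D1 :: Ds), (D0 :: Ds0).
  intros l l' l'' H. revert l''. clear - H HT.
  induction H; intros l'' H' IH; inversion H'; inversion IH; subst; eauto.
Qed.

(** Following first components, [S] reaches a base type, where the derivative type is [T] itself.
    There is always a first component because tuple types are non-empty. *)
Lemma same_primitive S T T' D D' :
  dty T S D -> dty T' S D' -> same_ty D D' -> same_ty T T'.
Proof.
  revert D D'; induction S as [b|S1 Ss IH| |] using ty_nested_ind; intros D D' HD HD' HDD;
    inversion HD; subst; inversion HD'; subst; auto.
  inversion HDD; subst. inversion IH; subst.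
  repeat match goal with H : Forall2 _ (_ :: _) (_ :: _) |- _ => inversion H; subst; clear H end.
  eauto.
Qed.

(** The body of a derivative or an integral is typed under a variable of the type of the point or
    bounds. The induction hypothesis for the body needs equal contexts, hence equality of these
    types and not only [same_ty]; [same_point] provides it. *)
Lemma type_unique G t T T' : has_type G t T -> has_type G t T' -> same_ty T T'.
Proof.
  revert G T T'; induction t using term_nested_ind; intros G A A' HA HA';
    inversion HA; subst; inversion HA'; subst; try apply same_refl; eauto using same_sum, same_arr.
  - replace A' with A by congruence. apply same_refl.
  - match goal with H1 : has_type _ t1 _, H2 : has_type _ t1 _ |- _ =>
      generalize (IHt1 _ _ _ H1 H2) end.
    inversion 1; auto.
  - apply same_tup. clear HA HA'. revert H H2 H3.
    generalize (T1 :: Ts), (T0 :: Ts0). intros m m' Hind H; revert m'.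
    induction H; intros m' H'; inversion H'; inversion Hind; subst; eauto.
  - match goal with H1 : has_type _ t _, H2 : has_type _ t _ |- _ =>
      generalize (IHt _ _ _ H1 H2) end.
    inversion 1; subst.
    match goal with H : Forall2 same_ty _ _ |- _ => apply (Forall2_nth _ _ _ H j); assumption end.
  - match goal with H1 : has_type _ t2 _, H2 : has_type _ t2 _, H : dty _ _ _ |- _ =>
      pose proof (same_point _ _ _ _ (IHt2 _ _ _ H1 H2) H) end.
    subst. eapply same_primitive; eauto.
  - match goal with H1 : has_type _ t2 _, H2 : has_type _ t2 _, H : dty _ _ _ |- _ =>
      pose proof (same_point _ _ _ _ (IHt2 _ _ _ H1 H2) H) end.
    subst. eapply same_derivative; eauto.
  - match goal with H1 : has_type _ t1 _, H2 : has_type _ t1 _, H : dty _ _ _ |- _ =>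
      pose proof (same_point _ _ _ _ (IHt1 _ _ _ H1 H2) H) end.
    subst. eapply same_primitive; eauto.
  - match goal with H1 : has_type _ t _, H2 : has_type _ t _ |- _ =>
      generalize (IHt _ _ _ H1 H2) end.
    inversion 1; auto.
Qed.

Lemma point_unique (G : ctx Sg) t S S' T D :
  has_type G t S -> has_type G t S' -> dty T S D -> S = S'.
Proof. intros H H'. apply same_point. eapply type_unique; eauto. Qed.

Lemma base_point_unique (G : ctx Sg) t S T D :
  has_base_type G t -> has_type G t S -> dty T S D -> exists b, S = TBase b.
Proof.
  intros [b Hb] HS HD. exists b. eapply point_unique; eauto.
Qed.


(** * Simulation between typed and annotated terms *)

Ltac unerase :=
  repeat match goal with
  | H : atype _ _ ?a _, E : erase ?a = ?t |- _ =>
      is_var a; first [is_var t; fail 1 | idtac];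
      destruct a; simpl in E; [discriminate E|]; inversion H; subst; clear H;
      match goal with H : lty _ _ _ _ _ |- _ => inversion H; subst; clear H end;
      repeat match goal with
      | H : Forall2 (atype _ _) _ (_ :: _ :: _) |- _ => inversion H; subst; clear H
      | H : Forall2 (atype _ _) _ [_] |- _ => inversion H; subst; clear H
      | H : Forall2 (fun _ _ => _) _ (_ :: _) |- _ => inversion H; subst; clear H
      | H : Forall2 _ _ [] |- _ => inversion H; subst; clear H
      end; simpl in E; try discriminate E; injection E as; subst
  end; simpl fst in *; simpl snd in *.

(** The side condition gives the point a base type, the annotation gives it a type too; uniqueness
    makes the annotation a [TBase], so the annotated rule fires. *)
Lemma red_annotated fx (G : ctx Sg) t t' a T :
  red G t t' -> atype fx G a T -> erase a = t -> exists a', rule a a' /\ erase a' = t'.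
Proof.
  intros Hr Ha E; destruct Hr; unerase;
    try match goal with
    | H : has_base_type _ (erase ?a), Ha : atype _ _ ?a ?S, Hd : dty _ ?S _ |- _ =>
        destruct (base_point_unique _ _ _ _ _ H (erase_atype _ _ _ _ Ha) Hd) as [b ->]
    end;
    try (eexists; split; [solve [constructor]|]; simpl; rewrite ?map_map, ?erase_aren;
         auto using erase_asubst1);
    try solve [unfold alift, lift; rewrite !erase_aren; auto];
    repeat match goal with
    | H : Forall2 (atype _ _) _ _ |- _ => apply Forall2_length in H
    end; rewrite ?length_map in *.
  - rewrite nth_error_map in H. destruct (nth_error ts0 j) as [a|] eqn:Ea; [|discriminate].
    injection H as <-. exists a. split; auto using r_proj.
  - eexists; split; [apply r_der_at_tup; assumption|].
    simpl. f_equal. apply erase_der_tup; assumption.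
  - rewrite <- (erase_int_tup (T1 :: Ts0)) in H0 by assumption.
    apply map_eq_cons in H0 as (a & us' & Ha & <- & <-).
    eexists; split; [apply r_int_between_tup; eassumption | apply erase_osum].
  - eexists; split; [apply r_op_tup; congruence|]. simpl. f_equal. apply erase_op_tup.
  - apply dty_tup_inv in H2 as (D1 & Ds & HD & H2). injection HD as <- <-.
    apply Forall2_length in H2.
    rewrite <- (erase_mul_tup (T1 :: Ts0)) in H0 by congruence.
    apply map_eq_cons in H0 as (a & us' & Ha & <- & <-).
    eexists; split; [apply r_mul_tup_tup; try eassumption; congruence | apply erase_osum].
Qed.

Lemma astep_arg0 l t t' ts bs : astep t t' -> astep (node l (t :: ts) bs) (node l (t' :: ts) bs).
Proof. apply astep_arg with (ts1 := []). Qed.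

Lemma astep_arg1 l t u u' ts bs :
  astep u u' -> astep (node l (t :: u :: ts) bs) (node l (t :: u' :: ts) bs).
Proof. apply astep_arg with (ts1 := [t]). Qed.

Lemma astep_body0 l ts b b' bs : astep b b' -> astep (node l ts (b :: bs)) (node l ts (b' :: bs)).
Proof. apply astep_body with (bs1 := []). Qed.

Lemma astep_body1 l ts c b b' bs :
  astep b b' -> astep (node l ts (c :: b :: bs)) (node l ts (c :: b' :: bs)).
Proof. apply astep_body with (bs1 := [c]). Qed.

Lemma step_annotated fx (G : ctx Sg) t t' a T :
  step G t t' -> atype fx G a T -> erase a = t -> exists a', astep a a' /\ erase a' = t'.
Proof.
  intros Hs; revert a T; induction Hs; intros a A Ha E.
  1: { destruct (red_annotated _ _ _ _ _ _ H Ha E) as (a' & ? & ?). eauto using astep_rule. }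
  4: { 
    unerase.
    match goal with H : map erase _ = _ |- _ =>
      apply map_eq_app in H as (us1 & us & -> & <- & H);
      apply map_eq_cons in H as (b & us2 & -> & <- & <-) end.
    match goal with H : Forall2 _ (us1 ++ b :: us2) _ |- _ =>
      apply Forall2_app_inv_l in H as (? & ? & _ & H & _); inversion H; subst end.
    edestruct IHHs as (b' & Hb & <-); [eassumption|reflexivity|].
    exists (aTup (us1 ++ b' :: us2)). split; [apply astep_arg; auto|].
    simpl. rewrite map_app. auto. }
  all: unerase.
  (* A step in the body of a derivative or integral is taken under some type of the point or bounds;
     by uniqueness it is the annotated one. *)
  all: try match goal with
    | H : has_type ?G (erase ?a) ?S, Ha : atype _ _ ?a ?S', Hd : dty _ ?S' _ |- _ =>
        assert (S' = S) as -> by exact (point_unique _ _ _ _ _ _ (erase_atype _ _ _ _ Ha) H Hd)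
    end.
  all: match goal with
    | IH : forall a T, atype _ _ a T -> erase a = erase ?x -> _, H : atype _ _ ?x _ |- _ =>
        destruct (IH _ _ H eq_refl) as (b & Hb & <-)
    end.
  all: eexists; split;
    [ first [ apply astep_arg0; eassumption | apply astep_arg1; eassumption
            | apply astep_body0; eassumption | apply astep_body1; eassumption ]
    | reflexivity ].
Qed.

Lemma rule_erase fx G a b T : rule a b -> atype fx G a T -> red G (erase a) (erase b).
Proof.
  intros Hr Ha; destruct Hr; atype_inv; simpl; rewrite ?erase_asubst1, ?erase_osum, ?erase_aren;
    unfold alift; rewrite ?erase_aren.
  (* Conversely, a subterm typed with a base type supplies the side condition [has_base_type]. *)
  all: repeat match goal with
    | H : atype _ _ _ (TBase _) |- _ =>
        apply erase_atype in H; apply ex_intro with (P := fun b => has_type _ _ (TBase b)) in H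
    end.
  all: try (constructor; assumption).
  - apply red_proj. apply map_nth_error; assumption.
  - replace (map erase (map _ _)) with (map (fun t => Der t (erase t0)) (map erase ts))
      by (rewrite !map_map; reflexivity).
    apply red_der_tup; assumption.
  - rewrite erase_der_tup by assumption. apply red_der_at_tup.
  - replace (map erase (map _ _)) with (map (fun t => Int (erase t1) (erase t2) t) (map erase ts))
      by (rewrite !map_map; reflexivity).
    apply red_int_tup; assumption.
  - apply red_int_between_tup; [rewrite !length_map; congruence|].
    rewrite <- (erase_int_tup (S1 :: Ss)), H1 by assumption. reflexivity.
  - rewrite erase_op_tup. apply red_op_tup. rewrite !length_map; assumption.
  - replace (map erase (map _ _)) with (map (fun t => Mul t (erase t0)) (map erase ts))
      by (rewrite !map_map; reflexivity).
    apply red_mul_tup_base; assumption.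
  - apply red_mul_tup_tup; [rewrite !length_map; congruence|].
    rewrite <- (erase_mul_tup (S1 :: Ss)), H1 by assumption. reflexivity.
Qed.

Ltac list_cases l := destruct l as [|? [|? ?]]; simpl app in *.

Lemma astep_erase fx (G : ctx Sg) a b T :
  astep a b -> atype fx G a T -> step G (erase a) (erase b).
Proof.
  intros Hs; revert G T; induction Hs; intros G A Ha.
  - apply step_red. eapply rule_erase; eauto.
  - inversion Ha as [|? ? ? ? Ts Bs ? Hl Ht Hb]; subst. destruct Hl.
    4: { simpl. rewrite !map_app. apply step_tup.
         apply Forall2_app_inv_l in Ht as (? & ? & _ & Ht & _). inversion Ht; subst; eauto. }
    all: list_cases ts1; repeat match goal with
      | H : Forall2 _ (_ :: _) _ |- _ => inversion H; subst; clear H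
      | H : Forall2 _ _ [] |- _ => inversion H; subst; clear H
      | H : Forall2 _ _ (_ :: _) |- _ => inversion H; subst; clear H
      end; simpl.
    all: try (constructor; eauto; fail).
    all: try match goal with
      | H : [] = _ ++ _ :: _ |- _ => apply app_cons_not_nil in H; contradiction
      end.
  - inversion Ha as [|? ? ? ? Ts Bs ? Hl Ht Hb]; subst. destruct Hl.
    all: list_cases bs1; repeat match goal with
      | H : Forall2 _ (_ :: _) _ |- _ => inversion H; subst; clear H
      | H : Forall2 _ _ [] |- _ => inversion H; subst; clear H
      | H : Forall2 _ _ (_ :: _) |- _ => inversion H; subst; clear H
      end; simpl in *.
    all: try (constructor; eauto; fail).
    all: try match goal with
      | H : [] = _ ++ _ :: _ |- _ => apply app_cons_not_nil in H; contradiction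
      end.
    + eapply step_der_body; eauto using erase_atype.
    + eapply step_int_body; eauto using erase_atype.
Qed.

(** * Preservation and confluence for typed terms *)

Lemma asteps_preservation fx G a b T : asteps a b -> atype fx G a T -> atype fx G b T.
Proof. induction 1; eauto using preservation. Qed.

Lemma steps_annotated fx (G : ctx Sg) t t' a T :
  steps G t t' -> atype fx G a T -> erase a = t -> exists a', asteps a a' /\ erase a' = t'.
Proof.
  intros Hs; revert a; induction Hs as [x y Hs|x|x y z _ IH1 _ IH2]; intros a Ha E.
  - destruct (step_annotated _ _ _ _ _ _ Hs Ha E) as (b & Hb & <-). eauto using rt_step.
  - eauto using rt_refl.
  - destruct (IH1 _ Ha E) as (b & Hab & Eb).
    destruct (IH2 b) as (c & Hbc & Ec); eauto using asteps_preservation, rt_trans.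
Qed.

Lemma asteps_erase fx (G : ctx Sg) a b T :
  asteps a b -> atype fx G a T -> steps G (erase a) (erase b).
Proof.
  induction 1 as [x y Hs|x|x y z Hxy IH1 _ IH2]; intros Ha.
  - eapply rt_step, astep_erase; eauto.
  - apply rt_refl.
  - apply rt_trans with (erase y); [exact (IH1 Ha)|]. apply IH2. eapply asteps_preservation; eauto.
Qed.

Lemma step_preservation (G : ctx Sg) t t' T : has_type G t T -> step G t t' -> has_type G t' T.
Proof.
  intros Ht Hs. destruct (elaboration true _ _ _ Ht) as (a & Ha & E); [discriminate|].
  destruct (step_annotated _ _ _ _ _ _ Hs Ha E) as (b & Hb & <-).
  eapply erase_atype, preservation; eauto.
Qed.

Lemma steps_preservation (G : ctx Sg) t t' T : steps G t t' -> has_type G t T -> has_type G t' T.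
Proof. induction 1; eauto using step_preservation. Qed.

(** Both reductions are lifted from one annotated term [a], joined there, and the join is erased. *)
Lemma steps_confluent (G : ctx Sg) t t1 t2 T :
  has_type G t T -> steps G t t1 -> steps G t t2 ->
  exists t3, steps G t1 t3 /\ steps G t2 t3.
Proof.
  intros Ht H1 H2. destruct (elaboration true _ _ _ Ht) as (a & Ha & E); [discriminate|].
  destruct (steps_annotated _ _ _ _ _ _ H1 Ha E) as (b & Hb & <-).
  destruct (steps_annotated _ _ _ _ _ _ H2 Ha E) as (c & Hc & <-).
  destruct (asteps_confluent _ _ _ Hb Hc) as (d & Hbd & Hcd).
  exists (erase d); split; eapply asteps_erase; eauto using asteps_preservation.
Qed.

(** * Normal forms *)

Ltac nf_inv :=
  repeat match goal with
  | H : nf _ ?t |- _ => tryif is_var t then fail else (inversion H; subst; clear H)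
  | H : nb _ ?t |- _ => tryif is_var t then fail else (inversion H; subst; clear H)
  end.

(** [step], [nb] and typing each bring their own type for a point or a bound; these types
    coincide. *)
Ltac unify_points :=
  repeat match goal with
  | H : has_type ?G ?a ?S, H' : has_type ?G ?a ?S', Hd : dty _ ?S _ |- _ =>
      tryif constr_eq S S' then fail else
      (pose proof (point_unique _ _ _ _ _ _ H H' Hd); subst)
  end.

(** A redex either has constructors where a normal form demands an [nb], or is headed by a
    projection, a case or a fixpoint, none of which is normal. *)
Lemma red_not_nf (G : ctx Sg) t t' : red G t t' -> ~ nf G t.
Proof. intros Hr Hn; destruct Hr; nf_inv. Qed.

Lemma step_not_nf (G : ctx Sg) t t' T : step G t t' -> has_type G t T -> ~ nf G t.
Proof.
  intros Hs; revert T; induction Hs; intros A Ht Hn.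
  1: { eapply red_not_nf; eauto. }
  all: inversion Ht; subst; nf_inv.
  all: try solve [eapply IHHs; eauto using nf_nb].
  all: try solve [unify_points; eapply IHHs; eauto using nf_nb].
  - eauto.
  - match goal with H : Forall2 _ _ _, H' : Forall _ _ |- _ =>
      apply Forall2_app_inv_l in H as (? & ? & _ & H & _); inversion H; subst;
      apply Forall_app in H' as [_ H']; inversion H'; subst end.
    eapply IHHs; eauto.
Qed.

Lemma nf_unique (G : ctx Sg) t t1 t2 T :
  has_type G t T -> steps G t t1 -> steps G t t2 -> nf G t1 -> nf G t2 -> t1 = t2.
Proof.
  intros Ht H1 H2 Hn1 Hn2.
  assert (Hnf : forall u v, has_type G u T -> nf G u -> steps G u v -> u = v).
  { intros u v Hu Hn Hs. apply clos_rt_rt1n in Hs. destruct Hs as [|w v Hs _]; auto.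
    exfalso; eapply step_not_nf; eauto. }
  destruct (steps_confluent _ _ _ _ _ Ht H1 H2) as (t3 & H13 & H23).
  rewrite (Hnf t1 t3), (Hnf t2 t3); eauto using steps_preservation.
Qed.

(** Interpretable types contain no tuples, and arrows cannot be differentiated along; so a point or
    second factor that is an [nb] has a base type, and differentiation along it leaves the type
    unchanged. It follows that normal forms of tuple and sum types are constructors. *)
Lemma nb_interpretable (G : ctx Sg) t T : nb G t -> has_type G t T -> interpretable T.
Proof.
  revert G T; induction t using term_nested_ind; intros G A Hn Ht;
    inversion Hn; subst; inversion Ht; subst; unify_points; eauto.
  - apply const_interp.
  - congruence.
  - match goal with H : has_type _ t1 _ |- _ => apply IHt1 in H; auto; inversion H; auto end.
  - match goal with H : has_type _ t2 _ |- _ =>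
      pose proof (IHt2 _ _ ltac:(eassumption) H) as HS end.
    inversion HS; subst; [|match goal with H : dty _ (TArr _ _) _ |- _ => inversion H end].
    match goal with H : dty _ _ _ |- _ => apply dty_base_inv in H; subst end. eauto.
  - match goal with H : has_type _ t2 _ |- _ =>
      pose proof (IHt2 _ _ ltac:(eassumption) H) as HS end.
    inversion HS; subst; [|match goal with H : dty _ (TArr _ _) _ |- _ => inversion H end].
    match goal with H : dty _ _ _ |- _ => apply dty_base_inv in H; subst end. eauto.
  - match goal with H : has_type _ t2 _ |- _ =>
      pose proof (IHt2 _ _ ltac:(eassumption) H) as HS end.
    inversion HS; subst; [|match goal with H : dty _ (TArr _ _) _ |- _ => inversion H end].
    match goal with H : dty _ _ _ |- _ => apply dty_base_inv in H; subst end. eauto.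
Qed.

Lemma nf_base (G : ctx Sg) t b : nf G t -> has_type G t (TBase b) -> nb G t.
Proof. intros Hn Ht. inversion Hn; subst; auto; inversion Ht. Qed.

Lemma nf_tuple (G : ctx Sg) t T1 Ts :
  nf G t -> has_type G t (TTup T1 Ts) -> exists ts, t = Tup ts /\ Forall2 (has_type G) ts (T1 :: Ts).
Proof.
  intros Hn Ht. inversion Hn; subst; inversion Ht; subst; eauto;
    match goal with H : nb _ _ |- _ => pose proof (nb_interpretable _ _ _ H Ht) as HT; inversion HT end.
Qed.

Lemma nf_sum (G : ctx Sg) t T1 T2 :
  nf G t -> has_type G t (TSum T1 T2) -> exists s u, t = Inj s u.
Proof.
  intros Hn Ht. inversion Hn; subst; inversion Ht; subst; eauto;
    match goal with H : nb _ _ |- _ => pose proof (nb_interpretable _ _ _ H Ht) as HT; inversion HT end.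
Qed.

Lemma nf_arrow (G : ctx Sg) t S T :
  nf G t -> has_type G t (TArr S T) -> nb G t \/ exists u, t = Lam S u.
Proof. intros Hn Ht. inversion Hn; subst; auto; inversion Ht; subst; eauto. Qed.

(** * Progress *)

Definition reducible (G : ctx Sg) t : Prop := exists t', step G t t'.

Lemma interpretable_fv_cons (G : ctx Sg) S t u :
  interpretable S -> interpretable_fv G u ->
  (forall i, occurs_free (Datatypes.S i) t = true -> occurs_free i u = true) ->
  interpretable_fv (S :: G) t.
Proof.
  intros HS Hu Ht [|i] U Hi HU; simpl in HU; [congruence|]. eapply Hu; eauto.
Qed.

Lemma progress (G : ctx Sg) t T :
  has_type G t T -> interpretable_fv G t -> nf G t \/ reducible G t.
Proof.
  assert (Hsub : forall (G : ctx Sg) t u, interpretable_fv G u ->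
    (forall i, occurs_free i t = true -> occurs_free i u = true) -> interpretable_fv G t)
    by (unfold interpretable_fv; eauto).
  revert G T; induction t using term_nested_ind; intros G A Ht Hfv; inversion Ht; subst;
    repeat match goal with
    | IH : forall G T, has_type G ?t T -> _ -> _, H : has_type G ?t _ |- _ =>
        specialize (IH _ _ H);
        assert (interpretable_fv G t) as Ht_fv by
          (apply Hsub with (1 := Hfv); intros i Hi; simpl; rewrite Hi, ?Bool.orb_true_r; auto);
        specialize (IH Ht_fv); clear Ht_fv
    end.
  all: repeat match goal with
    | IH : nf _ _ \/ reducible _ _ |- _ =>
       destruct IH as [?|[? ?]]; [|right; eexists; eauto using step_app1, step_app2, step_proj,
         step_op1, step_op2, step_mul1, step_mul2, step_der_point, step_int_lower, step_int_upper,
         step_inj, step_case, step_fix; fail]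
    end.
  - left. apply nf_nb, nb_cst.
  - left. eapply nf_nb, nb_var; eauto. eapply Hfv; eauto. simpl. apply Nat.eqb_refl.
  (* The type [T] of the bound variable need not be interpretable, so the induction hypothesis does
     not apply to the body; whether it reduces is decided classically. *)
  - destruct (classic (reducible (T :: G) t)) as [[t' Hs]|Hs].
    + right. exists (Lam T t'). apply step_lam; auto.
    + left. apply nf_lam. exact Hs.
  - match goal with Hn : nf G t1, H : has_type G t1 _ |- _ =>
      destruct (nf_arrow _ _ _ _ Hn H) as [Hb|[u ->]] end.
    + left. apply nf_nb, nb_app; auto.
    + right. eexists. apply step_red, red_beta.
  - assert (Forall (nf G) ts \/ exists ts1 t t' ts2, ts = ts1 ++ t :: ts2 /\ step G t t')
      as [Hn | (ts1 & t & t' & ts2 & -> & Hs)].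
    { assert (Hts : Forall (interpretable_fv G) ts).
      { apply Forall_forall. intros t Hin. apply Hsub with (1 := Hfv). intros i Hi. simpl.
        apply existsb_exists. eauto. }
      match goal with Hty : Forall2 _ ts _ |- _ => revert Hty end.
      generalize (T1 :: Ts). clear Ht Hfv. induction ts as [|t ts IH]; intros l Hty; auto.
      inversion Hty; inversion Hts; inversion H; subst.
      match goal with IHt : forall G T, has_type G t T -> _ |- _ =>
        edestruct IHt as [Hn|[t' Hs]]; [eassumption..| |] end.
      + edestruct IH as [Hns|(ts1 & u & u' & ts2 & -> & Hs)]; eauto.
        right. exists (t :: ts1), u, u', ts2; auto.
      + right. exists [], t, t', ts; auto. }
    + left. apply nf_tup; auto.
    + right. eexists. apply step_tup; eauto.
  - match goal with Hn : nf G t, H : has_type G t _ |- _ =>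
      destruct (nf_tuple _ _ _ _ Hn H) as (ts & -> & Hts) end.
    match goal with H : nth_error _ j = _ |- _ =>
      destruct (Forall2_nth_r _ _ _ Hts _ _ H) as (u & Hu & _) end.
    right. eexists. apply step_red, red_proj; eauto.
  - match goal with Hn : nf G t1, H : has_type G t1 _, Hn' : nf G t2, H' : has_type G t2 _ |- _ =>
      destruct A as [b|T1 Ts|S T|T1 T2];
      [ left; eauto using nf_nb, nb_op1, nf_base
      | destruct (nf_tuple _ _ _ _ Hn H) as (ts & -> & Hts);
        destruct (nf_tuple _ _ _ _ Hn' H') as (us & -> & Hus)
      | destruct (nf_arrow _ _ _ _ Hn H) as [Hb|[u ->]]; [left; eauto using nf_nb, nb_op1|];
        destruct (nf_arrow _ _ _ _ Hn' H') as [Hb|[v ->]]; [left; eauto using nf_nb, nb_op2|]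
      | ] end.
    + right. eexists. apply step_red, red_op_tup.
      rewrite (Forall2_length Hts), (Forall2_length Hus); auto.
    + right. eexists. apply step_red, red_op_lam.
    + match goal with H : addable _ |- _ => inversion H end.
  - match goal with Hn : nf G t1, H : has_type G t1 _, Hn' : nf G t2, H' : has_type G t2 _,
      Hd : dty _ ?S _ |- _ => destruct S as [b|S1 Ss|? ?|? ?]; [| |inversion Hd|inversion Hd] end.
    + match goal with Hd : dty _ _ _ |- _ => apply dty_base_inv in Hd; subst end.
      assert (Hb : has_base_type G t2) by (eexists; eassumption).
      match goal with Hn : nf G t1 |- _ => inversion Hn; subst end.
      * left. eauto using nf_nb, nb_mul, nf_base.
      * right. eexists. apply step_red, red_mul_tup_base; auto.
      * right. eexists. apply step_red, red_mul_lam; auto.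
      * right. eexists. apply step_red, red_mul_inj; auto.
    + match goal with Hd : dty _ _ _, Hn : nf G t1, H : has_type G t1 _, Hn' : nf G t2,
        H' : has_type G t2 _ |- _ =>
        apply dty_tup_inv in Hd as (D1 & Ds & -> & Hd);
        destruct (nf_tuple _ _ _ _ Hn H) as (ts & -> & Hts);
        destruct (nf_tuple _ _ _ _ Hn' H') as (us & -> & Hus);
        apply Forall2_length in Hd end.
      (* Exposing the first components lets [zip_with] compute to a non-empty list of summands. *)
      right. inversion Hts; subst; inversion Hus; subst. eexists. apply step_red.
      apply red_mul_tup_tup; [|reflexivity].
      rewrite (Forall2_length Hts), (Forall2_length Hus); auto.
  - match goal with Hn : nf G t2, H : has_type G t2 _, Hd : dty _ ?S _ |- _ =>
      destruct S as [b|S1 Ss|? ?|? ?]; [| |inversion Hd|inversion Hd] end.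
    + assert (Hb : has_base_type G t2) by (eexists; eassumption).
      edestruct IHt1 as [Hn|[t' Hs]]; [eassumption| | |].
      (* Unlike under an abstraction, the bound variable has the base type of the point, so the
         induction hypothesis applies to the body. *)
      * apply (interpretable_fv_cons G _ _ _ (interp_base _) Hfv). simpl.
        intros i ->. reflexivity.
      (* A normal body that is not an [nb] is a constructor, and a rule moves the derivative inside
         it. *)
      * inversion Hn; subst; [left|right; eexists; apply step_red; constructor; auto; fail..].
        eauto using nf_nb, nb_der, nf_base.
      * right. eexists. eapply step_der_body; eauto.
    + match goal with Hn : nf G t2, H : has_type G t2 _ |- _ =>
        destruct (nf_tuple _ _ _ _ Hn H) as (ts & -> & Hts) end.
      right. eexists. apply step_red, red_der_at_tup.
  - match goal with Hd : dty _ ?S _ |- _ =>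
      destruct S as [b|S1 Ss|? ?|? ?]; [| |inversion Hd|inversion Hd] end.
    + assert (Hb1 : has_base_type G t1) by (eexists; eassumption).
      assert (Hb2 : has_base_type G t2) by (eexists; eassumption).
      edestruct IHt3 as [Hn|[t' Hs]]; [eassumption| | |].
      * apply (interpretable_fv_cons G _ _ _ (interp_base _) Hfv). simpl.
        intros i ->. rewrite !Bool.orb_true_r. reflexivity.
      * inversion Hn; subst; [left|right; eexists; apply step_red; constructor; auto; fail..].
        eauto using nf_nb, nb_int, nf_base.
      * right. eexists. eapply step_int_body; eauto.
    + match goal with Hn : nf G t1, H : has_type G t1 _, Hn' : nf G t2, H' : has_type G t2 _ |- _ =>
        destruct (nf_tuple _ _ _ _ Hn H) as (ts & -> & Hts);
        destruct (nf_tuple _ _ _ _ Hn' H') as (us & -> & Hus) end.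
      right. inversion Hts; subst; inversion Hus; subst. eexists. apply step_red.
      eapply red_int_between_tup; [|reflexivity].
      rewrite (Forall2_length Hts), (Forall2_length Hus); auto.
  - left. apply nf_inj; auto.
  - left. apply nf_inj; auto.
  - match goal with Hn : nf G t1, H : has_type G t1 _ |- _ =>
      destruct (nf_sum _ _ _ _ Hn H) as ([|] & u & ->) end.
    + right. eexists. apply step_red, red_case_inl.
    + right. eexists. apply step_red, red_case_inr.
  - right. eexists. apply step_red, red_fix.
Qed.

(** * Strong normalization *)

Definition SN : tm -> Prop := Acc (fun b a => astep a b).

(** Makes the reductions inside the children of a node one relation on lists, well-founded on lists
    of [SN] terms. *)
Inductive lstep : list tm -> list tm -> Prop :=
| lstep_head t t' ts : astep t t' -> lstep (t :: ts) (t' :: ts)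
| lstep_tail t ts ts' : lstep ts ts' -> lstep (t :: ts) (t :: ts').

Lemma lstep_app ts1 t t' ts2 : astep t t' -> lstep (ts1 ++ t :: ts2) (ts1 ++ t' :: ts2).
Proof. intros; induction ts1; simpl; auto using lstep_head, lstep_tail. Qed.

Lemma lstep_acc ts : Forall SN ts -> Acc (fun us' us => lstep us us') ts.
Proof.
  induction 1 as [|t ts Ht _ IH].
  - constructor. intros us H; inversion H.
  - revert ts IH. induction Ht as [t _ IHt]. intros ts Hts. induction Hts as [ts Hts IHts].
    constructor. intros us H; inversion H; subst; auto.
    apply IHt; auto. constructor; auto.
Qed.

Lemma astep_node_inv l ts bs c :
  astep (node l ts bs) c ->
  rule (node l ts bs) c \/ (exists ts', c = node l ts' bs /\ lstep ts ts')
  \/ (exists bs', c = node l ts bs' /\ lstep bs bs').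
Proof. inversion 1; subst; eauto 6 using lstep_app. Qed.

Lemma children_ind (P : list tm -> list tm -> Prop) ts bs :
  Forall SN ts -> Forall SN bs ->
  (forall ts bs, (forall ts', lstep ts ts' -> P ts' bs) ->
                 (forall bs', lstep bs bs' -> P ts bs') -> P ts bs) ->
  P ts bs.
Proof.
  intros Ht Hb HP. apply lstep_acc in Ht, Hb. revert bs Hb.
  induction Ht as [ts _ IHt]. intros bs Hb. pose proof Hb as Hb'.
  induction Hb as [bs Hb IHb]. apply HP; auto.
Qed.

Lemma SN_constructor l ts bs :
  constructor_label l = true -> Forall SN ts -> Forall SN bs -> SN (node l ts bs).
Proof.
  intros Hl Ht Hb. apply (children_ind (fun ts bs => SN (node l ts bs))); auto.
  intros us cs IHt IHb. constructor. intros c Hc.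
  apply astep_node_inv in Hc as [Hc|[(us' & -> & Hc)|(cs' & -> & Hc)]].
  - exfalso; exact (rule_constructor _ _ _ _ Hl Hc).
  - exact (IHt _ Hc).
  - exact (IHb _ Hc).
Qed.

Lemma Forall2_asteps_refl us : Forall2 asteps us us.
Proof. induction us; auto using rt_refl. Qed.

Lemma Forall2_lstep us us' : lstep us us' -> Forall2 asteps us us'.
Proof.
  induction 1; constructor; auto using rt_step, rt_refl, Forall2_asteps_refl.
Qed.

Lemma Forall2_asteps_trans us vs ws :
  Forall2 asteps us vs -> Forall2 asteps vs ws -> Forall2 asteps us ws.
Proof.
  intros H; revert ws; induction H; intros ws H'; inversion H'; subst; eauto using rt_trans.
Qed.

Lemma asteps_constructor l ts bs v :
  asteps (node l ts bs) v -> constructor_label l = true ->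
  exists ts' bs', v = node l ts' bs' /\ Forall2 asteps ts ts' /\ Forall2 asteps bs bs'.
Proof.
  intros H Hl. apply clos_rt_rt1n in H. remember (node l ts bs) as a eqn:E.
  revert ts bs E. induction H as [a|a b c Hab _ IH]; intros ts bs ->.
  - eauto 6 using Forall2_asteps_refl.
  - apply astep_node_inv in Hab as [Hr|[(ts' & -> & Hs)|(bs' & -> & Hs)]].
    + exfalso; exact (rule_constructor _ _ _ _ Hl Hr).
    + destruct (IH _ _ eq_refl) as (ts2 & bs2 & -> & ? & ?). apply Forall2_lstep in Hs.
      eauto 6 using Forall2_asteps_trans.
    + destruct (IH _ _ eq_refl) as (ts2 & bs2 & -> & ? & ?). apply Forall2_lstep in Hs.
      eauto 6 using Forall2_asteps_trans.
Qed.

Lemma astep_asubst s a b : astep a b -> astep (asubst s a) (asubst s b).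
Proof.
  intros H; revert s; induction H; intros s.
  - apply astep_rule, rule_asubst; auto.
  - simpl. rewrite !map_app. apply astep_arg; auto.
  - simpl. rewrite !map_app. apply astep_body; auto.
Qed.

(** Every step of [a] is also a step of its instance. This will yield normalization of open bodies
    from that of their instances. *)
Lemma SN_asubst s a : SN (asubst s a) -> SN a.
Proof.
  intros H. remember (asubst s a) as b eqn:E. revert a E.
  induction H as [b _ IH]; intros a ->. constructor. intros c Hc.
  eapply IH; [apply astep_asubst; eassumption | reflexivity].
Qed.

(** Excludes only constructors of the wrong shape: variables and nodes that are not constructors fit
    every type. Reducibility speaks of untyped terms, so this has to be built in to rule out rules
    that do not match the type. *)
Definition fits (T : typ) (v : tm) : Prop :=
  match v, T with
  | node (LLam _) _ _, TArr _ _ => True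
  | node LTup _ _, TTup _ _ => True
  | node (LInj _) _ _, TSum _ _ => True
  | node l _ _, _ => constructor_label l = false
  | tvar _, _ => True
  end.

(* Reducibility: the components of all the values to which the term reduces are
   reducible. *)
Fixpoint RED (T : typ) (a : tm) {struct T} : Prop :=
  SN a /\
  forall v, asteps a v -> fits T v /\
    match T with
    | TBase _ => True
    | TTup T1 Ts => forall vs, v = aTup vs ->
        match vs with
        | [] => False
        | v1 :: vs => RED T1 v1 /\
            (fix all (Ts : list typ) (vs : list tm) {struct Ts} : Prop :=
               match Ts, vs with
               | [], [] => True
               | T :: Ts, v :: vs => RED T v /\ all Ts vs
               | _, _ => False
               end) Ts vs
        end
    | TArr A B => forall S t u, v = aLam S t -> RED A u -> RED B (asubst1 t u)
    | TSum T1 T2 => forall s t, v = aInj s t -> match s with L => RED T1 t | R => RED T2 t end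
    end.

Lemma RED_SN T a : RED T a -> SN a.
Proof. destruct T; intros [H _]; exact H. Qed.

Lemma RED_fits T a : RED T a -> fits T a.
Proof. destruct T; intros [_ H]; apply (H a (rt_refl _ _ _)). Qed.

Lemma SN_asteps a b : asteps a b -> SN a -> SN b.
Proof.
  induction 1 as [a b Hab| |]; auto. intros [Ha]. exact (Ha _ Hab).
Qed.

Lemma RED_asteps T a b : asteps a b -> RED T a -> RED T b.
Proof.
  intros Hab; destruct T; intros [Ha H];
    (split; [eauto using SN_asteps | intros v Hv; apply H; eauto using rt_trans]).
Qed.

(** The inner [fix], which keeps the recursion on types structural, is [Forall2 RED]. *)
Lemma RED_tup_unfold T1 Ts a :
  RED (TTup T1 Ts) a <->
  SN a /\ forall v, asteps a v -> fits (TTup T1 Ts) v /\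
                    forall vs, v = aTup vs -> Forall2 RED (T1 :: Ts) vs.
Proof.
  assert (Hall : forall Ts vs,
    (fix all (Ts : list typ) (vs : list tm) {struct Ts} : Prop :=
       match Ts, vs with
       | [], [] => True
       | T :: Ts, v :: vs => RED T v /\ all Ts vs
       | _, _ => False
       end) Ts vs <-> Forall2 RED Ts vs).
  { clear. induction Ts as [|T Ts IH]; intros [|v vs]; split; intros H; auto;
      try (inversion H; fail); try contradiction.
    - constructor; [apply H | apply IH, H].
    - inversion H; subst. split; [|apply IH]; auto. }
  split; (intros [Ha H]; split; [exact Ha|]; intros v Hv; destruct (H v Hv) as [Hf Hc];
    split; [exact Hf|]; intros vs E; specialize (Hc vs E)).
  - destruct vs as [|v1 vs]; [contradiction|]. constructor; [apply Hc | apply Hall, Hc].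
  - inversion Hc; subst. split; [|apply Hall]; auto.
Qed.

Lemma RED_tup_inv T1 Ts vs : RED (TTup T1 Ts) (aTup vs) -> Forall2 RED (T1 :: Ts) vs.
Proof. intros H. apply RED_tup_unfold in H as [_ H]. apply (H _ (rt_refl _ _ _)). auto. Qed.

Lemma RED_lam_inv A B S t u : RED (TArr A B) (aLam S t) -> RED A u -> RED B (asubst1 t u).
Proof. intros [_ H]. destruct (H _ (rt_refl _ _ _)) as [_ Hc]. eauto. Qed.

Lemma RED_inj_inv T1 T2 s t :
  RED (TSum T1 T2) (aInj s t) -> match s with L => RED T1 t | R => RED T2 t end.
Proof. intros [_ H]. destruct (H _ (rt_refl _ _ _)) as [_ Hc]. exact (Hc s t eq_refl). Qed.

(** Girard's third condition: every value of a term that is not a constructor is reached through one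
    of its one-step reducts. *)
Lemma RED_neutral T a :
  match a with tvar _ => True | node l _ _ => constructor_label l = false end ->
  (forall b, astep a b -> RED T b) -> RED T a.
Proof.
  intros Hl H.
  assert (Ha : SN a) by (constructor; intros b Hb; eapply RED_SN, H, Hb).
  assert (Hv : forall v, asteps a v -> v = a \/ exists b, RED T b /\ asteps b v).
  { intros v Hv. apply clos_rt_rt1n in Hv. destruct Hv as [|b v Hb Hv]; auto.
    right. exists b. split; auto. apply clos_rt1n_rt; auto. }
  assert (Hf : fits T a) by (destruct a as [|[] ? ?]; simpl in *; auto; discriminate).
  destruct T; split; try exact Ha; intros v Hav; destruct (Hv v Hav) as [->|(c & [_ Hc] & Hcv)];
    try exact (Hc v Hcv); split; try exact Hf; auto; intros; subst; discriminate Hl.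
Qed.

Lemma RED_var T i : RED T (tvar i).
Proof. apply RED_neutral; auto. intros b Hb; inversion Hb. inversion H. Qed.

Definition REDB (B : typ * typ) (b : tm) : Prop :=
  forall u, RED (fst B) u -> RED (snd B) (asubst1 b u).

(** Variables are reducible, so the body has a strongly normalizing instance; the index 0 is
    arbitrary. *)
Lemma REDB_SN B b : REDB B b -> SN b.
Proof. intros H. eapply SN_asubst, RED_SN, H, (RED_var _ 0). Qed.

Lemma REDB_asteps B b c : asteps b c -> REDB B b -> REDB B c.
Proof.
  intros Hbc H u Hu. eapply RED_asteps, H, Hu.
  clear - Hbc. induction Hbc; eauto using rt_refl, rt_trans.
  apply rt_step, astep_asubst; auto.
Qed.

Lemma Forall2_closed {A} (P : A -> tm -> Prop) xs us us' :
  (forall x u u', asteps u u' -> P x u -> P x u') ->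
  Forall2 asteps us us' -> Forall2 P xs us -> Forall2 P xs us'.
Proof.
  intros HP Hu; revert xs; induction Hu; intros xs Hx; inversion Hx; subst; eauto.
Qed.

Lemma Forall2_SN {A} (P : A -> tm -> Prop) xs us :
  (forall x u, P x u -> SN u) -> Forall2 P xs us -> Forall SN us.
Proof. induction 2; eauto. Qed.

(** The children may reduce before the rule at the root fires, whence the quantification over all
    reducible children in the second hypothesis. Steps inside the children are absorbed by
    [children_ind]. *)
Lemma RED_node l Ts Bs T ts bs :
  constructor_label l = false ->
  (forall ts bs b, Forall2 RED Ts ts -> Forall2 REDB Bs bs -> rule (node l ts bs) b -> RED T b) ->
  Forall2 RED Ts ts -> Forall2 REDB Bs bs -> RED T (node l ts bs).
Proof.
  intros Hl Hr Ht Hb.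
  apply (children_ind (fun ts bs => Forall2 RED Ts ts -> Forall2 REDB Bs bs -> RED T (node l ts bs)));
    auto.
  - eapply Forall2_SN; [exact RED_SN | eassumption].
  - eapply Forall2_SN; [exact REDB_SN | eassumption].
  - clear ts bs Ht Hb. intros ts bs IHt IHb Ht Hb. apply RED_neutral; auto.
    intros b H. apply astep_node_inv in H as [H|[(ts' & -> & H)|(bs' & -> & H)]]; eauto.
    + apply IHt; auto. eapply Forall2_closed; eauto using RED_asteps, Forall2_lstep.
    + apply IHb; auto. eapply Forall2_closed; eauto using REDB_asteps, Forall2_lstep.
Qed.

Lemma RED_tup T1 Ts ts : Forall2 RED (T1 :: Ts) ts -> RED (TTup T1 Ts) (aTup ts).
Proof.
  intros Ht. apply RED_tup_unfold. split.
  - apply SN_constructor; auto. eapply Forall2_SN; [exact RED_SN | eassumption].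
  - intros v Hv. apply asteps_constructor in Hv as (ts' & bs' & -> & Ht' & Hb'); auto.
    split; [exact I|]. intros vs E. injection E as <- _.
    eapply Forall2_closed; eauto using RED_asteps.
Qed.

Lemma RED_lam A B S t : REDB (A, B) t -> RED (TArr A B) (aLam S t).
Proof.
  intros Ht. split.
  - apply SN_constructor; auto. constructor; auto. eapply REDB_SN; eauto.
  - intros v Hv. apply asteps_constructor in Hv as (ts' & bs' & -> & Ht' & Hb'); auto.
    split; [exact I|]. intros S' t' u E. injection E as <- -> ->.
    inversion Hb'; subst. apply (REDB_asteps (A, B) t); auto.
Qed.

Lemma RED_inj T1 T2 s t :
  match s with L => RED T1 t | R => RED T2 t end -> RED (TSum T1 T2) (aInj s t).
Proof.
  intros Ht. split.
  - apply SN_constructor; auto. constructor; auto. destruct s; eapply RED_SN; eauto.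
  - intros v Hv. apply asteps_constructor in Hv as (ts' & bs' & -> & Ht' & Hb'); auto.
    split; [exact I|]. intros s' t' E. injection E as <- -> ->.
    inversion Ht'; subst. destruct s; eapply RED_asteps; eauto.
Qed.

(** * Reducibility of the operations *)

Ltac red_cases :=
  repeat match goal with
  | H : Forall2 RED (_ :: _) (_ :: _) |- _ => inversion H; subst; clear H
  | H : Forall2 REDB (_ :: _) (_ :: _) |- _ => inversion H; subst; clear H
  | H : Forall2 RED [] _ |- _ => inversion H; subst; clear H
  | H : Forall2 REDB [] _ |- _ => inversion H; subst; clear H
  end.

Lemma RED_op o T t u : addable T -> RED T t -> RED T u -> RED T (aOp o t u).
Proof.
  revert t u; induction T as [b|T1 Ts IH|A B _ IHB|] using ty_nested_ind; intros t u HT Ht Hu;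
    match goal with |- RED ?U _ => apply (RED_node _ [U; U] [] _ [t; u] []) end; auto; clear t u Ht Hu;
    intros ts bs c Ht Hb Hr; inversion Hr; subst; red_cases;
    (* Rules whose constructors do not match the type are refuted by [fits]. *)
    try match goal with H : RED _ _ |- _ => apply RED_fits in H; discriminate H end.
  - repeat match goal with H : RED _ (aTup _) |- _ => apply RED_tup_inv in H end.
    apply RED_tup. apply addable_tup_inv in HT.
    match goal with H1 : Forall2 _ _ ts1, H2 : Forall2 _ _ ts2 |- _ => revert H1 H2 end.
    clear - HT IH. revert ts1 ts2. revert HT IH. generalize (T1 :: Ts). intros l HT IH.
    induction l; intros ts1 ts2 H1 H2; inversion H1; inversion H2; inversion HT; inversion IH; subst;
      constructor; eauto.
  - apply RED_lam. intros u Hu. apply IHB; [inversion HT; auto| |]; eapply RED_lam_inv; eauto.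
Qed.

Lemma RED_osum T u us : addable T -> RED T u -> Forall (RED T) us -> RED T (aosum u us).
Proof.
  intros HT Hu H. unfold aosum. revert u Hu. induction H; intros; simpl; auto using RED_op.
Qed.

Lemma RED_mul_base b T t u : RED T t -> RED (TBase b) u -> RED T (aMul (TBase b) t u).
Proof.
  revert t u; induction T as [c|T1 Ts IH|A B _ IHB|T1 T2 IH1 IH2] using ty_nested_ind;
    intros t u Ht Hu;
    match goal with |- RED ?U _ => apply (RED_node _ [U; TBase b] [] _ [t; u] []) end; auto; clear t u Ht Hu;
    intros ts bs c' Ht Hb Hr; inversion Hr; subst; red_cases;
    try match goal with H : RED _ _ |- _ => apply RED_fits in H; discriminate H end.
  - match goal with H : RED _ (aTup _) |- _ => apply RED_tup_inv in H; rename H into Hts end.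
    apply RED_tup. apply Forall2_flip, Forall2_map_l, Forall2_flip.
    refine (Forall2_mono _ _ _ _ _ IH _ Hts). simpl. auto.
  - apply RED_lam. intros v Hv. change (RED B (aMul (TBase b) (asubst1 t v) (asubst1 (alift t0) v))).
    rewrite asubst1_alift. apply IHB; auto. eapply RED_lam_inv; eauto.
  - match goal with H : RED _ (aInj _ _) |- _ => apply RED_inj_inv in H end.
    apply RED_inj. destruct s; auto.
Qed.

(** Between tuples, the summands are products along the smaller types $S_i$ with the same result
    type [T]; addability of [T] makes their sum reducible. *)
Lemma RED_mul S T D t u :
  addable T -> dty T S D -> RED D t -> RED S u -> RED T (aMul S t u).
Proof.
  intros HT. revert D t u; induction S as [b|S1 Ss IH| |] using ty_nested_ind;
    intros D t u HD Ht Hu; try (inversion HD; fail).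
  - apply dty_base_inv in HD as ->. apply RED_mul_base; auto.
  - apply (RED_node _ [D; TTup S1 Ss] [] _ [t; u] []); auto. clear t u Ht Hu.
    intros ts bs c Ht Hb Hr; inversion Hr; subst; red_cases.
    apply dty_tup_inv in HD as (D1 & Ds & -> & HD).
    repeat match goal with H : RED _ (aTup _) |- _ => apply RED_tup_inv in H end.
    assert (Hu : Forall (RED T) (amul_tup (S1 :: Ss) ts1 ts2)).
    { match goal with H1 : Forall2 _ _ ts1, H2 : Forall2 _ _ ts2 |- _ => revert H1 H2 end.
      clear - IH HD. revert ts1 ts2.
      induction HD; intros ts1 ts2 H1 H2; inversion H1; inversion H2; inversion IH; subst;
        constructor; eauto. }
    match goal with H : amul_tup _ _ _ = _ |- _ => rewrite H in Hu end.
    inversion Hu; subst. apply RED_osum; auto.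
Qed.

Lemma Forall2_of_nth {A B} (R : A -> B -> Prop) l l' :
  length l = length l' ->
  (forall i x y, nth_error l i = Some x -> nth_error l' i = Some y -> R x y) -> Forall2 R l l'.
Proof. intros Hl H. rewrite <- (imap_id 0 l). apply Forall2_imap_l; auto. Qed.

(** Substitution acts componentwise on a body that is already a tuple, so the components of its
    reducible instances are the instances of its components. *)
Lemma REDB_tup_inv S T1 Ts ts :
  REDB (S, TTup T1 Ts) (aTup ts) -> Forall2 (fun T t => REDB (S, T) t) (T1 :: Ts) ts.
Proof.
  intros H.
  assert (Hu : forall u, RED S u -> Forall2 RED (T1 :: Ts) (map (fun t => asubst1 t u) ts)).
  { intros u Hu. apply RED_tup_inv. exact (H u Hu). }
  apply Forall2_of_nth.
  (* The instance at a variable has as many components as the body and is reducible at the tuple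
     type. *)
  - rewrite (Forall2_length (Hu _ (RED_var S 0))), length_map. auto.
  - intros i T t HT Ht u HuS. eapply (Forall2_nth _ _ _ (Hu u HuS)); [exact HT|].
    rewrite nth_error_map, Ht. auto.
Qed.

(** Instantiating the variable of the abstraction by [v] and the outer variable by [u] gives the
    same instance of [t] in either order, once the two indices are exchanged. *)
Lemma REDB_swap S A B U t v :
  REDB (S, TArr A B) (aLam U t) -> RED A v ->
  REDB (S, B) (asubst (aup (ascons v tvar)) (aren swap01 t)).
Proof.
  intros Ht Hv u Hu. cbn [snd fst] in *.
  pose proof (RED_lam_inv _ _ _ _ _ (Ht u Hu) Hv) as H.
  rewrite asubst1_aup in H |- *. rewrite asubst_aren.
  replace (fun i => ascons u (ascons v tvar) (swap01 i)) with (ascons v (ascons u tvar)); auto.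
  extensionality i; destruct i as [|[|i]]; auto.
Qed.

Lemma REDB_inj_inv S T1 T2 s t :
  REDB (S, TSum T1 T2) (aInj s t) -> match s with L => REDB (S, T1) t | R => REDB (S, T2) t end.
Proof. intros H. destruct s; intros u Hu; exact (RED_inj_inv _ _ _ _ (H u Hu)). Qed.

(** At a base point every rule pushes the derivative below the constructor of its body, towards
    smaller types [T]. *)
Lemma RED_der_base b T t t0 :
  REDB (TBase b, T) t -> RED (TBase b) t0 -> RED T (aDer (TBase b) t t0).
Proof.
  revert t t0; induction T as [c|T1 Ts IH|A B _ IHB|T1 T2 IH1 IH2] using ty_nested_ind;
    intros t t0 Ht Ht0;
    match goal with |- RED ?U _ =>
      apply (RED_node _ [TBase b] [(TBase b, U)] _ [t0] [t]) end; auto; clear t t0 Ht Ht0;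
    intros ts bs c' Ht Hb Hr; inversion Hr; subst; red_cases;
    (* An instance at a variable shows the head constructor of the body, which has to fit the
       type. *)
    try match goal with H : REDB _ _ |- _ =>
      specialize (H _ (RED_var _ 0)); apply RED_fits in H; discriminate H end.
  - match goal with H : REDB _ _ |- _ => apply REDB_tup_inv in H; rename H into Hts end.
    apply RED_tup. apply Forall2_flip, Forall2_map_l, Forall2_flip.
    refine (Forall2_mono _ _ _ _ _ IH _ Hts). simpl. auto.
  - apply RED_lam. intros v Hv.
    change (RED B (aDer (TBase b) (asubst (aup (ascons v tvar)) (aren swap01 t))
      (asubst1 (alift t0) v))).
    rewrite asubst1_alift. apply IHB; auto. eapply REDB_swap; eauto.
  - match goal with H : REDB _ _ |- _ => apply REDB_inj_inv in H end.
    apply RED_inj. destruct s; auto.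
Qed.

Lemma REDB_fresh T S1 Ss S t us vs i :
  REDB (TTup S1 Ss, T) t -> Forall2 RED (S1 :: Ss) us -> Forall2 RED (S1 :: Ss) vs ->
  nth_error (S1 :: Ss) i = Some S -> REDB (S, T) (asubst_fresh t (atup_star i us vs)).
Proof.
  intros Ht Hu Hv Hi v HvS. rewrite asubst1_fresh, asubst1_tup_star.
  apply Ht. apply RED_tup. eapply Forall2_splice; eauto.
Qed.

(** At a tuple, the i-th component is a derivative along the smaller type $S_i$, and the type [T] of
    the body is unchanged. *)
Lemma RED_der S T D t t0 : dty T S D -> REDB (S, T) t -> RED S t0 -> RED D (aDer S t t0).
Proof.
  revert D t t0; induction S as [b|S1 Ss IH| |] using ty_nested_ind;
    intros D t t0 HD Ht Ht0; try (inversion HD; fail).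
  - apply dty_base_inv in HD as ->. apply RED_der_base; auto.
  - apply (RED_node _ [TTup S1 Ss] [(TTup S1 Ss, T)] _ [t0] [t]); auto. clear t t0 Ht Ht0.
    intros ts bs c Ht Hb Hr; inversion Hr; subst; red_cases.
    apply dty_tup_inv in HD as (D1 & Ds & -> & HD).
    match goal with H : RED _ (aTup ?us) |- _ =>
      apply RED_tup_inv in H; rename H into Hts; rename us into us end.
    apply RED_tup, Forall2_flip, Forall2_imap_l.
    + rewrite length_combine, <- (Forall2_length Hts), (Forall2_length HD). lia.
    + intros i [S u] D Hi HDi. apply nth_error_combine in Hi as [HS Hu].
      rewrite Forall_forall in IH. apply (IH S); eauto using nth_error_In.
      * exact (Forall2_nth _ _ _ HD _ _ _ HS HDi).
      * eapply REDB_fresh; eauto.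
      * exact (Forall2_nth _ _ _ Hts _ _ _ HS Hu).
Qed.

Lemma RED_int_base b T t1 t2 t :
  RED (TBase b) t1 -> RED (TBase b) t2 -> REDB (TBase b, T) t ->
  RED T (aInt (TBase b) t1 t2 t).
Proof.
  revert t1 t2 t; induction T as [c|T1 Ts IH|A B _ IHB|T1 T2 IH1 IH2] using ty_nested_ind;
    intros t1 t2 t Ht1 Ht2 Ht;
    match goal with |- RED ?U _ =>
      apply (RED_node _ [TBase b; TBase b] [(TBase b, U)] _ [t1; t2] [t]) end; auto;
    clear t1 t2 t Ht1 Ht2 Ht;
    intros ts bs c' Ht Hb Hr; inversion Hr; subst; red_cases;
    try match goal with H : REDB _ _ |- _ =>
      specialize (H _ (RED_var _ 0)); apply RED_fits in H; discriminate H end.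
  - match goal with H : REDB _ _ |- _ => apply REDB_tup_inv in H; rename H into Hts end.
    apply RED_tup. apply Forall2_flip, Forall2_map_l, Forall2_flip.
    refine (Forall2_mono _ _ _ _ _ IH _ Hts). simpl. auto.
  - apply RED_lam. intros v Hv.
    change (RED B (aInt (TBase b) (asubst1 (alift t1) v) (asubst1 (alift t2) v)
      (asubst (aup (ascons v tvar)) (aren swap01 t)))).
    rewrite !asubst1_alift. apply IHB; auto. eapply REDB_swap; eauto.
  - match goal with H : REDB _ _ |- _ => apply REDB_inj_inv in H end.
    apply RED_inj. destruct s; auto.
Qed.

Lemma RED_proj j T1 Ts T t :
  nth_error (T1 :: Ts) j = Some T -> RED (TTup T1 Ts) t -> RED T (aProj j t).
Proof.
  intros Hj Ht. apply (RED_node _ [TTup T1 Ts] [] _ [t] []); auto. clear t Ht.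
  intros ts bs c Ht Hb Hr; inversion Hr; subst; red_cases.
  match goal with H : RED _ (aTup _) |- _ => apply RED_tup_inv in H;
    eapply (Forall2_nth _ _ _ H); eauto end.
Qed.

(** Between tuples, [REDB_fresh] and [RED_proj] make the i-th integrand reducible at $\partial
    T/\partial S_i$; the integral is then along a smaller type, with the same addable result [T]. *)
Lemma RED_int S T D t1 t2 t :
  addable T -> dty T S D -> RED S t1 -> RED S t2 -> REDB (S, D) t -> RED T (aInt S t1 t2 t).
Proof.
  intros HT. revert D t1 t2 t; induction S as [b|S1 Ss IH| |] using ty_nested_ind;
    intros D t1 t2 t HD Ht1 Ht2 Ht; try (inversion HD; fail).
  - apply dty_base_inv in HD as ->. apply RED_int_base; auto.
  - apply (RED_node _ [TTup S1 Ss; TTup S1 Ss] [(TTup S1 Ss, D)] _ [t1; t2] [t]); auto.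
    clear t1 t2 t Ht1 Ht2 Ht.
    intros ts bs c Ht Hb Hr; inversion Hr; subst; red_cases.
    apply dty_tup_inv in HD as (D1 & Ds & -> & HD).
    repeat match goal with H : RED _ (aTup _) |- _ => apply RED_tup_inv in H end.
    assert (Hu : Forall (RED T) (aint_tup (S1 :: Ss) ts1 ts2 t)).
    { apply Forall_imap. intros i [S [u1 u2]] Hx.
      apply nth_error_combine in Hx as [HS Hx].
      apply nth_error_combine in Hx as [Hu1 Hu2].
      destruct (Forall2_nth_l _ _ _ HD _ _ HS) as (Di & HDi & HDS).
      rewrite Forall_forall in IH. apply (IH S) with (D := Di); eauto using nth_error_In.
      - match goal with H : Forall2 RED _ ts1 |- _ => exact (Forall2_nth _ _ _ H _ _ _ HS Hu1) end.
      - match goal with H : Forall2 RED _ ts2 |- _ => exact (Forall2_nth _ _ _ H _ _ _ HS Hu2) end.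
      - assert (Hf : REDB (S, TTup D1 Ds) (asubst_fresh t (atup_star i ts2 ts1)))
          by (eapply REDB_fresh; eauto).
        intros w Hw. apply (RED_proj i D1 Ds); auto. exact (Hf w Hw). }
    match goal with H : aint_tup _ _ _ _ = _ |- _ => rewrite H in Hu end.
    inversion Hu; subst. apply RED_osum; auto.
Qed.

(** * Fundamental property of reducibility and strong normalization *)

Lemma RED_label l Ts Bs T ts bs :
  lty false l Ts Bs T -> Forall2 RED Ts ts -> Forall2 REDB Bs bs -> RED T (node l ts bs).
Proof.
  destruct 1; intros Ht Hb.
  4: { inversion Hb; subst. apply RED_tup; auto. }
  all: repeat match goal with
    | H : Forall2 _ (_ :: _) _ |- _ => inversion H; subst; clear H
    | H : Forall2 _ [] _ |- _ => inversion H; subst; clear H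
    end.
  - apply RED_neutral; auto. intros b Hb.
    apply astep_node_inv in Hb as [Hb|[(? & _ & Hb)|(? & _ & Hb)]]; inversion Hb.
  - apply RED_lam; auto.
  - match goal with H1 : RED (TArr S T) ?t, H2 : RED S ?u |- _ =>
      apply (RED_node _ [TArr S T; S] [] _ [t; u] []); auto; clear t u H1 H2 end.
    intros ts bs c Ht Hb Hr; inversion Hr; subst; red_cases. eapply RED_lam_inv; eauto.
  - eapply RED_proj; eauto.
  - apply RED_op; auto.
  - eapply RED_mul; eauto.
  - eapply RED_der; eauto.
  - eapply RED_int; eauto.
  - apply RED_inj; auto.
  - apply RED_inj; auto.
  - match goal with H0 : RED _ ?t, H1 : REDB _ ?u1, H2 : REDB _ ?u2 |- _ =>
      apply (RED_node _ [TSum T1 T2] [(T1, T); (T2, T)] _ [t] [u1; u2]); auto; clear t u1 u2 H0 H1 H2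
    end.
    intros ts bs c Ht Hb Hr; inversion Hr; subst; red_cases;
      match goal with H : RED _ (aInj _ _) |- _ => apply RED_inj_inv in H end;
      match goal with H : REDB _ ?u |- RED _ (asubst1 ?u _) => apply H; auto end.
  (* [LFix] is not typable when [fx] is [false]. *)
  - discriminate.
Qed.

(** Generalizing to reducible substitutions gives, under a binder, exactly the quantification over
    arguments in [REDB]; the identity substitution is reducible by [RED_var]. *)
Lemma RED_atype G a T s :
  atype false G a T -> (forall i U, nth_error G i = Some U -> RED U (s i)) -> RED T (asubst s a).
Proof.
  revert G T s; induction a as [i|l ts bs IHt IHb] using tm_nested_ind; intros G T s Ha Hs;
    inversion Ha as [|? ? ? ? Ts Bs ? Hl Ht Hb]; subst; simpl; auto.
  apply (RED_label _ _ _ _ _ _ Hl); apply Forall2_flip, Forall2_map_l.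
  - refine (Forall2_mono _ _ _ _ _ IHt _ Ht); simpl; eauto.
  - refine (Forall2_mono _ _ _ _ _ IHb _ Hb); simpl.
    intros b [S U] IH Hty u Hu. rewrite asubst1_aup. eapply IH; [exact Hty|].
    intros [|i] W Hi; simpl in *; [congruence | eauto].
Qed.

Lemma atype_SN G a T : atype false G a T -> SN a.
Proof.
  intros Ha. rewrite <- (asubst_tvar a). eapply RED_SN, RED_atype; eauto using RED_var.
Qed.

(** Each step of an infinite sequence lifts to the annotated term reached so far, so well-founded
    induction on annotated reduction refutes it, the sequence being shifted by one at each stage. *)
Lemma fix_free_normalizing (G : ctx Sg) t T :
  has_type G t T -> fix_free t = true -> strongly_normalizable G t.
Proof.
  intros Ht Hf [f [H0 Hstep]].
  destruct (elaboration false _ _ _ Ht) as (a & Ha & E); auto.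
  rewrite <- H0 in E. clear H0 Ht Hf.
  pose proof (atype_SN _ _ _ Ha) as Hsn. revert f Hstep E Ha.
  induction Hsn as [a _ IH]; intros f Hstep E Ha.
  destruct (step_annotated _ _ _ _ _ _ (Hstep 0) Ha E) as (b & Hab & Eb).
  apply (IH b Hab (fun n => f (S n))); eauto using preservation.
Qed.

End Calculus.

Theorem lemma5 (Sg : signature) :
  (forall (G : ctx Sg) (t : term Sg) (T : ty (base Sg)),
      has_type G t T -> interpretable_fv G t ->
      nf G t \/ exists t', step G t t')
  /\
  (forall (G : ctx Sg) (t t' : term Sg) (T : ty (base Sg)),
      has_type G t T -> interpretable_fv G t ->
      step G t t' -> has_type G t' T)
  /\
  ((forall (G : ctx Sg) (t t1 t2 : term Sg) (T : ty (base Sg)),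
      has_type G t T -> steps G t t1 -> steps G t t2 ->
      exists t3, steps G t1 t3 /\ steps G t2 t3)
   /\
   (forall (G : ctx Sg) (t t1 t2 : term Sg) (T : ty (base Sg)),
      has_type G t T -> steps G t t1 -> steps G t t2 ->
      nf G t1 -> nf G t2 -> t1 = t2))
  /\
  (forall (G : ctx Sg) (t : term Sg) (T : ty (base Sg)),
      has_type G t T -> fix_free t = true -> strongly_normalizable G t).
Proof.
  split; [exact progress|]. split; [eauto using step_preservation|].
  split; [split; [exact steps_confluent | exact nf_unique] | exact fix_free_normalizing].
Qed.
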